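(* Let $M$ be an $O(p)\times O(q)$-invariant hypersurface in the Euclidean space $\mathbb{E}^{p+q}$. If $M$ is biharmonic, i.e. $\Delta\overrightarrow{H}=0$, then $M$ is minimal, i.e. $\overrightarrow{H}=0$ identically.
   Context: An $O(p)\times O(q)$-invariant hypersurface of $\mathbb{E}^{p+q}=\mathbb{E}^p\times\mathbb{E}^q$ is a hypersurface invariant under the standard isometric action of $O(p)\times O(q)$; it can be parametrized by $$\bar x(t,\phi_1,\ldots,\phi_{p-1},\psi_1,\ldots,\psi_{q-1})=\big(x(t)\,\Phi(\phi_1,\ldots,\phi_{p-1}),\;y(t)\,\Psi(\psi_1,\ldots,\psi_{q-1})\big),$$ where $\Phi$ and $\Psi$ are orthogonal parametrizations of the unit spheres of $\mathbb{E}^p$ and $\mathbb{E}^q$, respectively, and $t\mapsto(x(t),y(t))$ is the profile curve. For a hypersurface $M$ of dimension $n=p+q-1$, $\overrightarrow{H}=\frac1n\operatorname{trace}h$ is the mean curvature vector field ($h$ the second fundamental form), and $\Delta$ is the Laplacian of $M$ (with the induced metric), applied componentwise to $\mathbb{E}^{p+q}$-valued functions. $M$ is biharmonic if $\Delta\overrightarrow{H}=0$. *)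

(* Defs.v *)
From HB Require Import structures.
From mathcomp Require Import all_boot all_order all_algebra.
From mathcomp Require Import all_classical all_reals all_analysis.

Set Implicit Arguments.
Unset Strict Implicit.
Unset Printing Implicit Defensive.

Import Order.TTheory GRing.Theory Num.Theory.
Import numFieldNormedType.Exports.

Local Open Scope classical_set_scope.
Local Open Scope ring_scope.

(* The Euclidean space E^m is 'rV[R]_m with the standard
   inner product u *m v^T. The norm carried by 'rV[R]_m in the library is the
   sup norm; it is used only for its topology and its notion of derivative. *)

Definition partial (R : realType) (n : nat) (V : normedModType R) (i : 'I_n)
    (F : 'rV[R]_n -> V) : 'rV[R]_n -> V :=
  fun u => 'D_('e_i) F u.

(* Every iterated partial derivative of F is differentiable, hence continuous,
   on U; for open U this is F being C^oo on U. *)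
Definition smooth_on (R : realType) (n : nat) (V : normedModType R)
    (U : set 'rV[R]_n) (F : 'rV[R]_n -> V) : Prop :=
  forall (s : seq 'I_n) (u : 'rV[R]_n), U u ->
    differentiable (foldr (@partial R n V) F s) u.

(* Local geometry of an immersion X of an open subset of R^n in E^m. Row i of
   'J X u is the coordinate tangent vector of X along the i-th coordinate, and
   metric X u is the matrix g_ij of the induced metric. *)

Definition metric (R : realType) (n m : nat) (X : 'rV[R]_n -> 'rV[R]_m)
    (u : 'rV[R]_n) : 'M[R]_n :=
  'J X u *m ('J X u)^T.

(* w minus its orthogonal projection sum_kl g^kl <w, X_k> X_l on the tangent
   space *)
Definition normal_part (R : realType) (n m : nat) (X : 'rV[R]_n -> 'rV[R]_m)
    (u : 'rV[R]_n) (w : 'rV[R]_m) : 'rV[R]_m :=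
  w - w *m ('J X u)^T *m invmx (metric X u) *m 'J X u.

(* h(X_i, X_j), by the Gauss formula *)
Definition second_fundamental_form (R : realType) (n m : nat)
    (X : 'rV[R]_n -> 'rV[R]_m) (u : 'rV[R]_n) (i j : 'I_n) : 'rV[R]_m :=
  normal_part X u (partial i (partial j X) u).

Definition mean_curvature_vector (R : realType) (n m : nat)
    (X : 'rV[R]_n -> 'rV[R]_m) (u : 'rV[R]_n) : 'rV[R]_m :=
  n%:R^-1 *: \sum_(i < n) \sum_(j < n)
    invmx (metric X u) i j *: second_fundamental_form X u i j.

(* (det g)^(-1/2) sum_i d_i ((det g)^(1/2) sum_j g^ij d_j phi), the Laplacian
   of the induced metric. The opposite sign convention gives the same
   biharmonic hypersurfaces. *)
Definition laplacian (R : realType) (n m : nat) (X : 'rV[R]_n -> 'rV[R]_m)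
    (phi : 'rV[R]_n -> R) (u : 'rV[R]_n) : R :=
  (Num.sqrt (\det (metric X u)))^-1 *
  \sum_(i < n) partial i (fun v : 'rV[R]_n =>
    Num.sqrt (\det (metric X v)) *
    \sum_(j < n) invmx (metric X v) i j * partial j phi v : R) u.

Definition vector_laplacian (R : realType) (n m : nat)
    (X : 'rV[R]_n -> 'rV[R]_m) (Y : 'rV[R]_n -> 'rV[R]_m)
    (u : 'rV[R]_n) : 'rV[R]_m :=
  \row_(k < m) laplacian X (fun v => Y v ord0 k) u.

Definition smooth_immersion (R : realType) (n m : nat) (U : set 'rV[R]_n)
    (X : 'rV[R]_n -> 'rV[R]_m) : Prop :=
  smooth_on U X /\ forall u, U u -> row_free ('J X u).

(* c is the inverse of a chart of M: a homeomorphism of the open set U of R^n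
   onto an open subset of M, in which f is a smooth immersion. *)
Definition parametrization (R : realType) (n m : nat) (M : topologicalType)
    (f : M -> 'rV[R]_m) (U : set 'rV[R]_n) (c : 'rV[R]_n -> M) : Prop :=
  [/\ open U, {within U, continuous c}, set_inj U c,
      (forall V : set 'rV[R]_n, open V -> V `<=` U -> open (c @` V)) &
      smooth_immersion U (f \o c)].

(* f is an immersion in E^m of the n-manifold M. No atlas on M is needed: for
   parametrizations c and c', f \o c and f \o c' are immersions, which forces
   the coordinate change from c to c' to be smooth. So f determines a unique
   smooth structure on M for which it is an immersion, and parametrizations
   are the inverses of the charts of the corresponding maximal atlas. *)
Definition immersed_submanifold (R : realType) (n m : nat)
    (M : topologicalType) (f : M -> 'rV[R]_m) : Prop :=
  [/\ hausdorff_space M, @second_countable M &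
      forall x : M, exists U : set 'rV[R]_n, exists c : 'rV[R]_n -> M,
        parametrization f U c /\ (c @` U) x].

Definition immersed_hypersurface (R : realType) (m : nat)
    (M : topologicalType) (f : M -> 'rV[R]_m) : Prop :=
  @immersed_submanifold R m.-1 m M f.

Definition biharmonic (R : realType) (m : nat) (M : topologicalType)
    (f : M -> 'rV[R]_m) : Prop :=
  forall (U : set 'rV[R]_m.-1) (c : 'rV[R]_m.-1 -> M),
    parametrization f U c -> forall u, U u ->
    vector_laplacian (f \o c) (mean_curvature_vector (f \o c)) u = 0.

Definition minimal (R : realType) (m : nat) (M : topologicalType)
    (f : M -> 'rV[R]_m) : Prop :=
  forall (U : set 'rV[R]_m.-1) (c : 'rV[R]_m.-1 -> M),
    parametrization f U c -> forall u, U u ->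
    mean_curvature_vector (f \o c) u = 0.

Definition orthogonal_group (R : realType) (p : nat) : set 'M[R]_p :=
  [set A | A *m A^T = 1%:M].

(* (x, y) |-> (A x, B y); the transposes turn the products of matrices and
   column vectors into products of row vectors and matrices *)
Definition OpOq_act (R : realType) (p q : nat) (A : 'M[R]_p) (B : 'M[R]_q)
    (z : 'rV[R]_(p + q)) : 'rV[R]_(p + q) :=
  row_mx (lsubmx z *m A^T) (rsubmx z *m B^T).

(* The action of O(p) x O(q) on E^(p+q) comes, through f, from a continuous
   action a on M; the values of a off the orthogonal groups are irrelevant.
   When f is a topological embedding this says that f @` setT is an invariant
   set. *)
Definition OpOq_invariant (R : realType) (p q : nat) (M : topologicalType)
    (f : M -> 'rV[R]_(p + q)) : Prop :=
  exists a : 'M[R]_p -> 'M[R]_q -> M -> M,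
  [/\ {within (@orthogonal_group R p `*` @orthogonal_group R q) `*` setT,
        continuous (fun z : 'M[R]_p * 'M[R]_q * M => a z.1.1 z.1.2 z.2)},
      (forall x, a 1%:M 1%:M x = x),
      (forall A A' B B' x,
        orthogonal_group A -> orthogonal_group A' ->
        orthogonal_group B -> orthogonal_group B' ->
        a (A *m A') (B *m B') x = a A B (a A' B' x)) &
      (forall A B x, orthogonal_group A -> orthogonal_group B ->
        f (a A B x) = OpOq_act A B (f x))].

(* Main.v *)
From HB Require Import structures.
Require Import Defs.
From mathcomp Require Import all_boot all_order all_algebra.
From mathcomp Require Import all_classical all_reals all_analysis.
From mathcomp Require Import perm ring lra.

(* The argument is local and uses a single parametrization X = (x, y). By
   Beltrami's formula the Laplacian of X is n times the mean curvature vector.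
   The orbits are tangent to M, so where this vector, x and y do not vanish it
   is lam (a x / r, b y / s) with r = |x|, s = |y| and a^2 + b^2 = 1. (Where one
   coordinate of X vanishes on an open set, M is a hyperplane.) Let D be the
   derivation along the unit field (b x / r, - a y / s); then D r = b,
   D s = - a, D a = k b and D b = - k a. The symmetry of second derivatives shows
   that the derivatives of r, s, a, b, k along the orbits vanish, and on functions
   with this property the Laplacian is D^2 + delta D with
   delta = (p - 1) b / r - (q - 1) a / s, while
   lam = - (k + (p - 1) a / r + (q - 1) b / s).
   Biharmonicity becomes two equations for lam a and lam b. Their tangential
   combination is (2 k - lam) D lam = 0. If D lam = 0 then the normal combination
   forces lam = 0. Otherwise lam = 2 k, and eliminating (b / a)^2 between the
   normal combination and its derivative shows that (b / s) / (a / r) is a root of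
   a nonzero polynomial. So it is constant, hence so is b / a, and k = 0. *)

(** [M] is only an abstract immersed hypersurface, so no profile curve is constructed. The functions
    [r], [s], [a], [b] are read off a chart from the coordinates of [X] and their Laplacians, with
    [Lap X / lam] as unit normal. This normal exists only where the mean curvature is nonzero, and
    there the aim is a contradiction. Nonvanishing conditions are gained by shrinking to smaller
    nonempty open sets: a function vanishing on a whole open set can be differentiated, and its
    derivative gives the contradiction. The right sides of the two equations come from the orbit
    spheres: along an orbit the coordinates of [x / r] are eigenfunctions, with eigenvalue of size
    [(p - 1) / r^2]. The eliminated polynomial must be nonzero for every pair of dimensions at once.
    Its value at 0 settles this for [p > 1]; for [p = 1], where the orbits of O(1) are finite, that
    value is 0 and the elimination is replaced by a direct argument. *)

Set Implicit Arguments.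
Unset Strict Implicit.
Unset Printing Implicit Defensive.

Import Order.TTheory GRing.Theory Num.Theory.
Import numFieldNormedType.Exports.

Local Open Scope classical_set_scope.
Local Open Scope ring_scope.

(** * Smooth functions on an open set *)

(* [partial] for scalar functions, with values in [R] and not in the normed
   module [R]. It is locked because comparing two derivatives up to conversion
   unfolds limits. *)
HB.lock Definition pd (R : realType) (n : nat) (i : 'I_n) (F : 'rV[R]_n -> R) :
  'rV[R]_n -> R := partial i F.

Lemma pdE (R : realType) (n : nat) (i : 'I_n) (F : 'rV[R]_n -> R) :
  pd i F = partial i F.
Proof. by rewrite pd.unlock. Qed.

Section Smooth.
Context {R : realType} {n : nat}.
Variable W : set 'rV[R]_n.
Hypothesis Wo : open W.
Implicit Types (F G : 'rV[R]_n -> R) (i j : 'I_n) (u : 'rV[R]_n).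

Lemma eq_partial i F G : {in W, F =1 G} -> {in W, pd i F =1 pd i G}.
Proof.
move=> FG u uW; rewrite !pdE; apply: near_eq_derive; rewrite inE in uW.
have := open_nbhs_nbhs (conj Wo uW); apply: filterS => v Wv.
by apply: FG; rewrite inE.
Qed.

Lemma eq_differentiable F G u : {in W, F =1 G} -> W u ->
  differentiable F u -> differentiable G u.
Proof.
move=> FG uW dF.
have E : \forall h \near (0 : 'rV[R]_n), F (h + u) = G (h + u).
  have /nbhs0P := open_nbhs_nbhs (conj Wo uW).
  by apply: filterS => h Wh; apply: FG; rewrite inE addrC.
have E0 : F u = G u by apply: FG; rewrite inE.
have dFc : continuous ('d F u) := ((diff_locallyxP _ _).1 dF).1.
have H : G \o shift u = cst (G u) + 'd F u +o_ (0 : 'rV[R]_n) id.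
  apply/eqaddoP => e e0; have /eqaddoP/(_ _ e0) := diff_locally dF.
  by apply: filterS2 E => h /= Eh; rewrite !fctE/= Eh -E0.
have dG := diff_unique dFc H.
by apply/diff_locallyP; rewrite dG.
Qed.

Lemma eq_smooth F G : {in W, F =1 G} -> smooth_on W F -> smooth_on W G.
Proof.
move=> FG sF s u uW; apply: eq_differentiable uW (sF s u uW).
by elim: s => //= i s IH; rewrite -!pdE; exact: eq_partial.
Qed.

Lemma smooth_differentiable F u : smooth_on W F -> W u -> differentiable F u.
Proof. exact: (fun sF => sF [::] u). Qed.

Lemma smooth_partial i F : smooth_on W F -> smooth_on W (pd i F).
Proof. by move=> sF s u uW; have := sF (rcons s i) u uW; rewrite foldr_rcons pdE. Qed.

Lemma smooth_continuous F u : smooth_on W F -> W u -> {for u, continuous F}.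
Proof. by move=> sF uW; apply/differentiable_continuous/smooth_differentiable. Qed.

(** Coinduction for smoothness: it suffices to find a class of differentiable functions stable under
    partial derivatives. Stability is required only up to equality on [W], because the rules of
    calculus are available only there. *)
Lemma smooth_coind (P : ('rV[R]_n -> R) -> Prop) :
  (forall F u, P F -> W u -> differentiable F u) ->
  (forall F i, P F -> exists2 G, {in W, pd i F =1 G} & P G) ->
  forall F, P F -> smooth_on W F.
Proof.
move=> Pd PS F PF s u uW.
have [G FG PG] : exists2 G, {in W, foldr (@partial R n R) F s =1 G} & P G.
  elim: s => [|i s [G FG PG]] /=; first by exists F.
  have [H GH PH] := PS _ i PG; exists H => // v vW.
  by rewrite -pdE (eq_partial _ FG)// GH.
by apply: eq_differentiable (Pd _ _ PG uW) => // v vW; rewrite FG.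
Qed.

Lemma smooth_cst (c : R) : smooth_on W (fun=> c).
Proof.
apply: (@smooth_coind (fun F => exists c, F = fun=> c)); last by exists c.
  by move=> _ u [k ->] _; apply: differentiable_cst.
move=> _ i [k ->]; exists (fun=> 0); last by exists 0.
by move=> u _; rewrite pdE /partial derive_cst.
Qed.

Lemma partial_cst (c : R) i u : pd i (fun=> c) u = 0.
Proof. by rewrite pdE; exact: derive_cst. Qed.

Lemma partialD i F G u : differentiable F u -> differentiable G u ->
  pd i (fun v => F v + G v) u = pd i F u + pd i G u.
Proof. by move=> sF sG; rewrite !pdE; apply: deriveD; apply: diff_derivable. Qed.

Lemma partialN i F u : differentiable F u ->
  pd i (fun v => - F v) u = - pd i F u.
Proof. by move=> sF; rewrite !pdE; apply: deriveN; apply: diff_derivable. Qed.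

Lemma partialB i F G u : differentiable F u -> differentiable G u ->
  pd i (fun v => F v - G v) u = pd i F u - pd i G u.
Proof. by move=> sF sG; rewrite !pdE; apply: deriveB; apply: diff_derivable. Qed.

Lemma partialM i F G u : differentiable F u -> differentiable G u ->
  pd i (fun v => F v * G v) u = F u * pd i G u + G u * pd i F u.
Proof. by move=> sF sG; rewrite !pdE; apply: deriveM; apply: diff_derivable. Qed.

Lemma partialV i F u : differentiable F u -> F u != 0 ->
  pd i (fun v => (F v)^-1) u = - (F u) ^- 2 * pd i F u.
Proof. by move=> sF F0; rewrite !pdE; apply: deriveV => //; apply: diff_derivable. Qed.

Lemma differentiable_sqrt F u : differentiable F u -> 0 < F u ->
  differentiable (fun v => Num.sqrt (F v)) u.
Proof.
move=> dF F0.
have sqD : is_derive (F u) (1 : R) Num.sqrt (2 * Num.sqrt (F u))^-1.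
  exact: is_derive1_sqrt.
apply: (@differentiable_comp _ _ _ _ F Num.sqrt) => //.
by apply/derivable1_diffP; apply: ex_derive.
Qed.

Lemma partial_sqrt i F u : differentiable F u -> 0 < F u ->
  pd i (fun v => Num.sqrt (F v)) u = (2 * Num.sqrt (F u))^-1 * pd i F u.
Proof.
move=> dF F0; rewrite !pdE /partial.
have sqD : is_derive (F u) (1 : R) Num.sqrt (2 * Num.sqrt (F u))^-1.
  exact: is_derive1_sqrt.
have dS : differentiable (Num.sqrt : R -> R) (F u).
  by apply/derivable1_diffP; apply: ex_derive.
rewrite deriveE; last exact: differentiable_sqrt.
rewrite (@diff_comp _ _ _ _ F Num.sqrt)//= diff1E // -deriveE // derive1E.
by rewrite derive_val [_ *: _]mulrC.
Qed.

Lemma partial_sum (I : Type) (r : seq I) (P : pred I) i (F : I -> 'rV[R]_n -> R) u :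
  (forall k, differentiable (F k) u) ->
  pd i (fun v => \sum_(k <- r | P k) F k v) u =
  \sum_(k <- r | P k) pd i (F k) u.
Proof.
move=> dF; elim: r => [|k r IH].
  rewrite big_nil; under eq_fun do rewrite big_nil; exact: partial_cst.
rewrite big_cons -IH; under eq_fun do rewrite big_cons.
case: (P k) => //; rewrite partialD//.
have -> : (fun v => \sum_(j <- r | P j) F j v) = \sum_(j <- r | P j) F j.
  by apply/funext => v; rewrite fct_sumE.
by elim/big_ind : _ => // ? ? g h; apply: differentiableD; [exact:g|exact:h].
Qed.

(* Closed under partial derivatives up to equality on [W], as [smooth_coind]
   requires. *)
Inductive smooth_expr : ('rV[R]_n -> R) -> Prop :=
| expr_smooth F : smooth_on W F -> smooth_expr F
| exprD F G : smooth_expr F -> smooth_expr G -> smooth_expr (fun v => F v + G v)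
| exprM F G : smooth_expr F -> smooth_expr G -> smooth_expr (fun v => F v * G v)
| exprV F : smooth_expr F -> (forall u, W u -> F u != 0) -> smooth_expr (fun v => (F v)^-1)
| expr_sqrt F : smooth_expr F -> (forall u, W u -> 0 < F u) ->
    smooth_expr (fun v => Num.sqrt (F v)).

Lemma smooth_expr_differentiable F u : smooth_expr F -> W u -> differentiable F u.
Proof.
move=> + uW; elim=> {F} [F sF|F G _ dF _ dG|F G _ dF _ dG|F _ dF F0|F _ dF F0].
- exact: smooth_differentiable.
- exact: differentiableD.
- exact: differentiableM.
- by apply: differentiableV => //; apply: F0.
- by apply: differentiable_sqrt => //; apply: F0.
Qed.

Lemma smooth_expr_partial F i : smooth_expr F -> exists2 G, {in W, pd i F =1 G} & smooth_expr G.
Proof.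
have dif := smooth_expr_differentiable.
elim=> {F} [F sF|F G aF [F' EF aF'] aG [G' EG aG']|F G aF [F' EF aF'] aG [G' EG aG']
  |F aF [F' EF aF'] F0|F aF [F' EF aF'] F0].
- by exists (pd i F) => //; apply/expr_smooth/smooth_partial.
- exists (fun v => F' v + G' v); last exact: exprD.
  by move=> v vW; rewrite inE in vW; rewrite partialD ?EF ?EG ?inE//; exact: dif.
- exists (fun v => F v * G' v + G v * F' v); last by apply: exprD; apply: exprM.
  by move=> v vW; rewrite inE in vW; rewrite partialM ?EF ?EG ?inE//; exact: dif.
- exists (fun v => - 1 * ((F v)^-1 * (F v)^-1) * F' v).
    move=> v vW; rewrite -EF//; rewrite inE in vW.
    by rewrite (partialV _ (dif _ _ aF vW) (F0 _ vW)) expr2 invfM mulN1r.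
  apply: exprM => //; apply: exprM; first exact/expr_smooth/smooth_cst.
  by apply: exprM; apply: exprV.
- exists (fun v => (2 * Num.sqrt (F v))^-1 * F' v).
    move=> v vW; rewrite -EF//; rewrite inE in vW.
    by rewrite (partial_sqrt _ (dif _ _ aF vW) (F0 _ vW)).
  apply: exprM => //; apply: exprV.
    by apply: exprM; [exact/expr_smooth/smooth_cst | exact: expr_sqrt].
  by move=> v vW; rewrite mulf_neq0 ?pnatr_eq0// gt_eqF// sqrtr_gt0 F0.
Qed.

Lemma smooth_expr_smooth F : smooth_expr F -> smooth_on W F.
Proof.
apply: smooth_coind; [exact: smooth_expr_differentiable|exact: smooth_expr_partial].
Qed.

Lemma smoothD F G : smooth_on W F -> smooth_on W G ->
  smooth_on W (fun v => F v + G v).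
Proof. by move=> sF sG; apply/smooth_expr_smooth/exprD; apply: expr_smooth. Qed.

Lemma smoothM F G : smooth_on W F -> smooth_on W G ->
  smooth_on W (fun v => F v * G v).
Proof. by move=> sF sG; apply/smooth_expr_smooth/exprM; apply: expr_smooth. Qed.

Lemma smoothN F : smooth_on W F -> smooth_on W (fun v => - F v).
Proof.
move=> sF; under eq_fun do rewrite -mulN1r.
by apply: smoothM => //; apply: smooth_cst.
Qed.

Lemma smoothB F G : smooth_on W F -> smooth_on W G ->
  smooth_on W (fun v => F v - G v).
Proof. by move=> sF sG; apply: smoothD => //; apply: smoothN. Qed.

Lemma smoothV F : smooth_on W F -> (forall u, W u -> F u != 0) ->
  smooth_on W (fun v => (F v)^-1).
Proof. by move=> sF F0; apply/smooth_expr_smooth/exprV => //; apply: expr_smooth. Qed.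

Lemma smooth_sqrt F : smooth_on W F -> (forall u, W u -> 0 < F u) ->
  smooth_on W (fun v => Num.sqrt (F v)).
Proof. by move=> sF F0; apply/smooth_expr_smooth/expr_sqrt => //; apply: expr_smooth. Qed.

Lemma smoothX F k : smooth_on W F -> smooth_on W (fun v => F v ^+ k).
Proof.
move=> sF; elim: k => [|k IH]; first exact: smooth_cst.
by under eq_fun do rewrite exprS; apply: smoothM.
Qed.

Lemma smooth_sum (I : Type) (r : seq I) (P : pred I) (F : I -> 'rV[R]_n -> R) :
  (forall k, smooth_on W (F k)) ->
  smooth_on W (fun v => \sum_(k <- r | P k) F k v).
Proof.
move=> sF; elim: r => [|k r IH].
  by under eq_fun do rewrite big_nil; apply: smooth_cst.
under eq_fun do rewrite big_cons; case: (P k) => //; exact: smoothD.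
Qed.

Lemma smooth_prod (I : Type) (r : seq I) (P : pred I) (F : I -> 'rV[R]_n -> R) :
  (forall k, smooth_on W (F k)) ->
  smooth_on W (fun v => \prod_(k <- r | P k) F k v).
Proof.
move=> sF; elim: r => [|k r IH].
  by under eq_fun do rewrite big_nil; apply: smooth_cst.
under eq_fun do rewrite big_cons; case: (P k) => //; exact: smoothM.
Qed.
End Smooth.

(** * Symmetry of second derivatives *)

Section Schwarz.
Context {R : realType} {n : nat}.
Variable W : set 'rV[R]_n.
Hypothesis Wo : open W.
Implicit Types (F G : 'rV[R]_n -> R) (i j : 'I_n) (u : 'rV[R]_n).

Lemma partial_shift i F c u :
  pd i (fun v => F (c + v)) u = pd i F (c + u).
Proof.
rewrite !pdE /partial /derive.
have -> : (fun v => F (c + v)) \o shift u = F \o shift (c + u) => //.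
by apply/funext => h; rewrite /= addrCA.
Qed.

Lemma differentiable_shift F c u : differentiable F (c + u) ->
  differentiable (fun v => F (c + v)) u.
Proof.
move=> dF; apply: (@differentiable_comp _ _ _ _ (fun v => c + v)) => //.
Qed.

Lemma partial_line i F p (s : R) : differentiable F (s *: 'e_i + p) ->
  is_derive s (1 : R) (fun t : R => F (t *: 'e_i + p)) (pd i F (s *: 'e_i + p)).
Proof.
move=> dF; rewrite pdE.
have dl : is_diff s (fun t : R => t *: 'e_i + p) (fun t : R => t *: ('e_i : 'rV[R]_n)).
  have : is_diff s (( *:%R ^~ ('e_i : 'rV[R]_n)) + cst p)
      (( *:%R ^~ ('e_i : 'rV[R]_n)) + 0).
    apply: is_diffD; exact _.
  by rewrite addr0.
have dg := @ex_diff _ _ _ _ _ _ _ dl.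
have dc : differentiable (F \o (fun t : R => t *: 'e_i + p)) s.
  exact: differentiable_comp.
apply: DeriveDef; first exact/diff_derivable.
rewrite [LHS](deriveE _ dc) (diff_comp dg dF) /= (@diff_val _ _ _ _ _ _ _ dl).
by rewrite scale1r -deriveE.
Qed.

Lemma mean_value_line i F p (h : R) : 0 < h ->
  (forall s, 0 <= s <= h -> differentiable F (s *: 'e_i + p)) ->
  exists2 s, 0 <= s <= h &
    F (h *: 'e_i + p) - F p = h * pd i F (s *: 'e_i + p).
Proof.
move=> h0 dF.
have [||s sI E] := @MVT R (fun t => F (t *: 'e_i + p))
  (fun t => pd i F (t *: 'e_i + p)) 0 h h0.
- move=> s; rewrite in_itv/= => /andP[s0 sh].
  by apply: partial_line; apply: dF; rewrite !ltW.
- apply: derivable_within_continuous => s; rewrite in_itv/= => sI.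
  by have [] := partial_line (dF _ sI).
exists s; first by move: sI; rewrite in_itv/= => /andP[? ?]; rewrite !ltW.
by move: E; rewrite scale0r add0r subr0 mulrC.
Qed.

(** The mean value theorem is used twice: along ['e_i] for the increment [F (h *: 'e_j + v) - F v],
    then along ['e_j] for [pd i F]. The left side is symmetric in [i] and [j], so it is also a value
    of the other mixed derivative. *)
Lemma second_difference i j F u (h : R) : 0 < h -> smooth_on W F ->
  (forall s t, 0 <= s <= h -> 0 <= t <= h -> W (s *: 'e_i + (t *: 'e_j + u))) ->
  exists s t, [/\ 0 <= s <= h, 0 <= t <= h &
    F (h *: 'e_i + (h *: 'e_j + u)) - F (h *: 'e_j + u)
    - (F (h *: 'e_i + u) - F u) =
    h * h * pd j (pd i F) (s *: 'e_i + (t *: 'e_j + u))].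
Proof.
move=> h0 sF HW.
have h0h : 0 <= h <= h by rewrite lexx ltW.
have h00 : 0 <= (0 : R) <= h by rewrite lexx ltW.
pose P v := F (h *: 'e_j + v) - F v.
have dd s t : 0 <= s <= h -> 0 <= t <= h ->
    differentiable F (s *: 'e_i + (t *: 'e_j + u)).
  by move=> hs ht; apply: (smooth_differentiable sF); exact: HW.
have [|s hs Es] := @mean_value_line i (fun v => F (h *: 'e_j + v) - F v) u h h0.
  move=> s hs; apply: differentiableB; last first.
    by have := dd s 0 hs h00; rewrite scale0r add0r.
  by apply: differentiable_shift; rewrite addrCA; apply: dd.
have E2 : pd i (fun v => F (h *: 'e_j + v) - F v) (s *: 'e_i + u) =
   pd i F (h *: 'e_j + (s *: 'e_i + u)) - pd i F (s *: 'e_i + u).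
  have dF v : differentiable F v -> derivable F v 'e_i by exact: diff_derivable.
  have hs' := dd s h hs h0h; have hs0 := dd s 0 hs h00.
  rewrite scale0r add0r in hs0; rewrite addrCA in hs'.
  by rewrite partialB; [rewrite partial_shift|exact: differentiable_shift|].
have [|t ht Et] := @mean_value_line j (pd i F) (s *: 'e_i + u) h h0.
  move=> t ht; apply: (smooth_differentiable (smooth_partial _ sF)).
  by rewrite addrCA; apply: HW.
exists s, t; split; [exact: hs|exact: ht|].
rewrite [s *: _ + (t *: _ + u)]addrCA -[h * h * _]mulrA -Et -E2 -Es.
rewrite [h *: 'e_j + (h *: 'e_i + u)]addrCA; ring.
Qed.

(** If the mixed derivatives differed by [e] at [u], each would stay within [e / 2] of its value on
    a ball; but the symmetric second difference makes them take a common value there. *)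
Lemma partialC i j F u : smooth_on W F -> W u ->
  pd i (pd j F) u = pd j (pd i F) u.
Proof.
move=> sF uW; apply/eqP; rewrite -subr_eq0 -normr_eq0 -[_ == 0]negbK.
rewrite -normr_gt0 normr_id; apply/negP => e0.
set a := pd i (pd j F) u in e0 *; set b := pd j (pd i F) u in e0 *.
set e := `|a - b| in e0.
have e20 : 0 < e / 2 by rewrite divr_gt0.
have ca : {for u, continuous (pd i (pd j F))}.
  by apply: (smooth_continuous (smooth_partial _ (smooth_partial _ sF))).
have cb : {for u, continuous (pd j (pd i F))}.
  by apply: (smooth_continuous (smooth_partial _ (smooth_partial _ sF))).
have /nbhs_ballP[d d0 Hd] : \forall v \near u, [/\ W v,
    `|a - pd i (pd j F) v| < e / 2 &
    `|b - pd j (pd i F) v| < e / 2].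
  have H1 := open_nbhs_nbhs (conj Wo uW).
  have H2 : \forall v \near u, `|a - pd i (pd j F) v| < e / 2.
    by move/cvgrPdist_lt: ca; apply.
  have H3 : \forall v \near u, `|b - pd j (pd i F) v| < e / 2.
    by move/cvgrPdist_lt: cb; apply.
  by apply: filterS (filterI H1 (filterI H2 H3)) => v [? [? ?]]; split.
have dpos : 0 < d by [].
(* The points of the second differences are at distance at most [2 * h] from [u], since basis
   vectors have sup norm at most 1. *)
pose h := d / 4.
have h0 : 0 < h by rewrite divr_gt0.
have near_u k l s t : 0 <= s <= h -> 0 <= t <= h ->
    ball u d (s *: 'e_k + (t *: 'e_l + u)).
  move=> /andP[s0 sh] /andP[t0 th]; rewrite -ball_normE /=.
  rewrite addrA opprD addrCA subrr addr0 normrN.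
  rewrite (le_lt_trans (ler_normD _ _))// !normrZ.
  have ek (k' : 'I_n) : `|'e_k' : 'rV[R]_n| <= 1.
    rewrite [leLHS]/Num.Def.normr/= mx_normrE bigmax_le// => -[x y] _ /=.
    by rewrite !mxE; case: (_ && _); rewrite ?normr1 ?normr0.
  rewrite (@le_lt_trans _ _ (h * 1 + h * 1))//.
    by rewrite lerD// ler_pM// ger0_norm.
  rewrite mulr1 /h; lra.
have [|s [t [hs ht E1]]] := @second_difference i j F u h h0 sF.
  by move=> s t hs ht; have [] := Hd _ (near_u i j s t hs ht).
have [|s' [t' [hs' ht' E2]]] := @second_difference j i F u h h0 sF.
  by move=> s' t' hs' ht'; have [] := Hd _ (near_u j i s' t' hs' ht').
have [_ _ B1] := Hd _ (near_u i j s t hs ht).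
have [_ B2 _] := Hd _ (near_u j i s' t' hs' ht').
have E : pd j (pd i F) (s *: 'e_i + (t *: 'e_j + u)) =
         pd i (pd j F) (s' *: 'e_j + (t' *: 'e_i + u)).
  have hh : h * h != 0 by rewrite mulf_neq0// gt_eqF.
  apply: (mulfI hh); apply: etrans (esym E1) _; apply: etrans _ E2.
  by rewrite [h *: 'e_j + (h *: 'e_i + u)]addrCA; ring.
rewrite E distrC in B1.
have := le_lt_trans (ler_distD _ _ _) (ltrD B2 B1).
by rewrite -splitr ltxx.
Qed.

End Schwarz.

(** * Matrix-valued functions *)

Section SmoothMatrix.
Context {R : realType} {n : nat}.
Variable W : set 'rV[R]_n.
Hypothesis Wo : open W.
Implicit Types (i j : 'I_n) (u : 'rV[R]_n).

Lemma smooth_det k (g : 'rV[R]_n -> 'M[R]_k) :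
  (forall a b, smooth_on W (fun v => g v a b)) ->
  smooth_on W (fun v => \det (g v)).
Proof.
move=> sg; rewrite /determinant; apply: (smooth_sum Wo) => s.
apply: (smoothM Wo); first exact: (smooth_cst Wo).
by apply: (smooth_prod Wo) => a; apply: sg.
Qed.

Lemma smooth_invmx k (g : 'rV[R]_n -> 'M[R]_k) a b :
  (forall a b, smooth_on W (fun v => g v a b)) ->
  (forall v, W v -> g v \in unitmx) ->
  smooth_on W (fun v => invmx (g v) a b).
Proof.
move=> sg gu.
apply: (eq_smooth Wo (F := fun v => (\det (g v))^-1 *
    ((-1) ^+ (b + a) * \det (row' b (col' a (g v)))))).
  move=> v; rewrite inE => vW; rewrite /invmx gu//.
  by rewrite !mxE /cofactor /=.
apply: (smoothM Wo).
  apply: (smoothV Wo); first exact: smooth_det.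
  by move=> v vW; have := gu v vW; rewrite unitmxE unitfE.
apply: (smoothM Wo); first exact: (smooth_cst Wo).
apply: smooth_det => c d; under eq_fun do rewrite !mxE; exact: sg.
Qed.

Lemma partial_prod (I : eqType) (r : seq I) i (F : I -> 'rV[R]_n -> R) u :
  uniq r -> (forall k, smooth_on W (F k)) -> W u ->
  pd i (fun v => \prod_(k <- r) F k v) u =
  \sum_(k <- r) pd i (F k) u * \prod_(l <- r | l != k) F l u.
Proof.
move=> + sF uW; elim: r => [_|k r IH /= /andP[kr ur]].
  by rewrite big_nil; under eq_fun do rewrite big_nil; exact: partial_cst.
under eq_fun do rewrite big_cons; rewrite partialM.
- rewrite IH// big_cons addrC; congr (_ + _).
    rewrite mulrC big_cons eqxx /=; congr (_ * _).
    rewrite [LHS]big_seq [RHS]big_seq_cond; apply: eq_bigl => l.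
    by case: (boolP (l \in r)) => //= lr; apply/esym; apply: contraNneq kr => <-.
  rewrite mulr_sumr [LHS]big_seq [RHS]big_seq; apply: eq_bigr => l lr.
  rewrite big_cons ifT; first by rewrite mulrCA.
  by apply: contraNneq kr => ->.
- exact: (smooth_differentiable (sF k)).
- by apply: smooth_differentiable (uW); apply: (smooth_prod Wo).
Qed.

Lemma partial_det k i (g : 'rV[R]_n -> 'M[R]_k) u :
  (forall a b, smooth_on W (fun v => g v a b)) -> W u ->
  pd i (fun v => \det (g v)) u =
  \sum_a \sum_b pd i (fun v => g v a b) u * cofactor (g u) a b.
Proof.
move=> sg uW; rewrite /determinant partial_sum; last first.
  move=> s; apply: smooth_differentiable (uW); apply: (smoothM Wo).
    exact: (smooth_cst Wo).
  by apply: (smooth_prod Wo) => a; apply: sg.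
(* The matrix [g u] with row [a] differentiated: by multilinearity the derivative of the determinant
   is the sum of the [\det (M a)]. *)
pose M a := \matrix_(c, b) (if c == a then pd i (fun v => g v a b) u else g u c b).
transitivity (\sum_a \det (M a)); last first.
  apply: eq_bigr => a _; rewrite (expand_det_row _ a); apply: eq_bigr => b _.
  rewrite !mxE eqxx; congr (_ * _); rewrite /cofactor; congr (_ * \det _).
  by apply/matrixP => c d; rewrite !mxE eq_sym (negbTE (neq_lift _ _)).
rewrite /determinant exchange_big /=; apply: eq_bigr => s _.
have sp : smooth_on W (fun v => \prod_a g v a (s a)).
  by apply: (smooth_prod Wo) => a; apply: sg.
rewrite partialM; [|exact: differentiable_cst|exact: smooth_differentiable uW].
rewrite partial_cst mulr0 addr0 -mulr_sumr; congr (_ * _).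
rewrite partial_prod//; last exact: index_enum_uniq.
apply: eq_bigr => a _; rewrite [RHS](bigD1 a)//= mxE eqxx; congr (_ * _).
by apply: eq_bigr => c ca; rewrite mxE (negbTE ca).
Qed.

(** Jacobi's formula. *)
Lemma partial_det_unit k i (g : 'rV[R]_n -> 'M[R]_k) u :
  (forall a b, smooth_on W (fun v => g v a b)) -> W u -> g u \in unitmx ->
  pd i (fun v => \det (g v)) u = \det (g u) *
  \sum_a \sum_b invmx (g u) b a * pd i (fun v => g v a b) u.
Proof.
move=> sg uW gu; rewrite partial_det// mulr_sumr; apply: eq_bigr => a _.
rewrite mulr_sumr; apply: eq_bigr => b _.
rewrite /invmx gu !mxE -!mulrA mulVKr -?unitmxE//.
by rewrite /cofactor mulrA mulrC.
Qed.

Lemma differentiable_coord_fun m (X : 'rV[R]_n -> 'rV[R]_m) k u :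
  differentiable X u -> differentiable (fun v => X v ord0 k) u.
Proof.
move=> dX; apply: (@differentiable_comp _ _ _ _ X (fun v : 'rV[R]_m => v ord0 k)) => //.
exact: differentiable_coord.
Qed.

Lemma partial_coord m i (X : 'rV[R]_n -> 'rV[R]_m) k u :
  differentiable X u ->
  pd i (fun v => X v ord0 k) u = partial i X u ord0 k.
Proof.
move=> dX; rewrite pdE [in RHS]/partial derive_mx ?mxE//.
exact: diff_derivable.
Qed.

Lemma smooth_coord m (X : 'rV[R]_n -> 'rV[R]_m) k :
  smooth_on W X -> smooth_on W (fun v => X v ord0 k).
Proof.
move=> sX; apply: (smooth_coind Wo (P := fun F =>
  exists2 Y : 'rV[R]_n -> 'rV[R]_m, smooth_on W Y & F = fun v => Y v ord0 k)); last by exists X.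
  move=> _ u [Y sY ->] uW; apply: differentiable_coord_fun; exact: (sY [::] u).
move=> _ i [Y sY ->]; exists (fun v => partial i Y v ord0 k).
  by move=> u; rewrite inE => uW; apply: partial_coord; exact: (sY [::] u).
exists (partial i Y) => // s u uW; have := sY (rcons s i) u uW.
by rewrite foldr_rcons.
Qed.

Lemma jacobian_coord m (X : 'rV[R]_n -> 'rV[R]_m) u i k :
  differentiable X u -> 'J X u i k = pd i (fun v => X v ord0 k) u.
Proof.
move=> dX; rewrite partial_coord// /partial deriveEjacobian//.
by rewrite -rowE [RHS]mxE.
Qed.

End SmoothMatrix.

(** * The induced metric *)

Section Gram.
Context {R : realType}.

Lemma mulmx_trmx_row0 n (v : 'rV[R]_n) :
  (v *m v^T) ord0 ord0 = \sum_k v ord0 k ^+ 2.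
Proof. by rewrite mxE; apply: eq_bigr => k _; rewrite mxE. Qed.

Lemma sum_sqr_ge0 (I : Type) (r : seq I) (P : pred I) (F : I -> R) :
  0 <= \sum_(k <- r | P k) F k ^+ 2.
Proof. by apply: sumr_ge0 => k _; apply: sqr_ge0. Qed.

Lemma sqr_norm_gt0 n (v : 'rV[R]_n) : v != 0 -> 0 < (v *m v^T) ord0 ord0.
Proof.
move=> v0; rewrite mulmx_trmx_row0 lt_neqAle sum_sqr_ge0 andbT eq_sym.
apply: contra v0; rewrite psumr_eq0 => [/allP h|? _]; last exact: sqr_ge0.
apply/eqP/rowP => k; rewrite mxE; have := h k (mem_index_enum _).
by rewrite /= sqrf_eq0 => /eqP.
Qed.

(* The determinant does not vanish on the segment from the identity to a Gram
   matrix. *)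
Lemma det_gram_gt0 n m (A : 'M[R]_(n, m)) : row_free A -> 0 < \det (A *m A^T).
Proof.
move=> Af; rewrite ltNge; apply/negP => g0.
pose g := A *m A^T.
pose Q : 'M[{poly R}]_n := (map_mx polyC 1%:M) + 'X *: map_mx polyC (g - 1%:M).
have Qt t : (\det Q).[t] = \det (1%:M + t *: (g - 1%:M)).
  rewrite -[LHS]/(horner_eval t _) -det_map_mx; congr (\det _).
  by apply/matrixP => i j; rewrite !mxE /= /horner_eval !hornerE.
have [t /andP[t0 t1] /rootP rt] : exists2 t, 0 <= t <= 1 & root (- \det Q) t.
  apply: poly_ivt; first exact: ler01.
  rewrite !hornerN !Qt scale0r addr0 det1 scale1r addrC subrK.
  by rewrite oppr_le0 ler01 oppr_ge0.
(* A kernel vector [v] at the root [t] gives [(1 - t) |v|^2 + t |v A|^2 = 0], although both squares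
   are positive and [t] is in [0, 1]. *)
move/eqP: rt; rewrite hornerN oppr_eq0 Qt => /det0P[v v0 /(congr1 (mulmx^~ v^T))].
have -> : v *m (1%:M + t *: (g - 1%:M)) *m v^T =
    (1 - t) *: (v *m v^T) + t *: (v *m A *m (v *m A)^T).
  rewrite trmx_mul mulmxDr mulmx1 -scalemxAr mulmxBr mulmx1 mulmxDl -scalemxAl.
  by rewrite mulmxBl /g !mulmxA scalerBr scalerBl scale1r -addrA [- _ + _]addrC.
rewrite mul0mx => /matrixP/(_ 0 0); rewrite ![in LHS]mxE [RHS]mxE.
set a := \sum_j _; set b := \sum_j _ => E.
have ap : 0 < a by have := sqr_norm_gt0 v0; rewrite mxE.
have vA : v *m A != 0.
  apply: contra v0 => /eqP vA0; apply/eqP.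
  by apply: (row_free_inj Af); rewrite vA0 mul0mx.
have bp : 0 < b by have := sqr_norm_gt0 vA; rewrite mxE.
have : 0 < (1 - t) * a + t * b.
  have [->|tn] := eqVneq t 1; first by rewrite subrr mul0r add0r mul1r.
  apply: ltr_wpDr; first exact: mulr_ge0 t0 (ltW bp).
  by apply: mulr_gt0 => //; rewrite subr_gt0 lt_neqAle tn.
by rewrite E ltxx.
Qed.

End Gram.

HB.lock Definition coordf (R : realType) (n m : nat)
    (X : 'rV[R]_n -> 'rV[R]_m) (k : 'I_m) (v : 'rV[R]_n) : R := X v ord0 k.

HB.lock Definition invg (R : realType) (n m : nat)
    (X : 'rV[R]_n -> 'rV[R]_m) (i j : 'I_n) (v : 'rV[R]_n) : R :=
  invmx (metric X v) i j.

HB.lock Definition vol (R : realType) (n m : nat)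
    (X : 'rV[R]_n -> 'rV[R]_m) (v : 'rV[R]_n) : R :=
  Num.sqrt (\det (metric X v)).

(* The Laplacian with locked ingredients; see [lap_laplacian]. *)
HB.lock Definition lap (R : realType) (n m : nat)
    (X : 'rV[R]_n -> 'rV[R]_m) (F : 'rV[R]_n -> R) (u : 'rV[R]_n) : R :=
  (vol X u)^-1 *
  \sum_i pd i (fun v => vol X v * \sum_j invg X i j v * pd j F v) u.

HB.lock Definition grad_dot (R : realType) (n m : nat)
    (X : 'rV[R]_n -> 'rV[R]_m) (F H : 'rV[R]_n -> R) (u : 'rV[R]_n) : R :=
  \sum_i \sum_j invg X i j u * pd i F u * pd j H u.

(* The first-order coefficients of the Laplacian. *)
HB.lock Definition lap_drift (R : realType) (n m : nat)
    (X : 'rV[R]_n -> 'rV[R]_m) (j : 'I_n) (u : 'rV[R]_n) : R :=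
  (vol X u)^-1 * \sum_i pd i (fun v => vol X v * invg X i j v) u.

Section Immersion.
Context {R : realType} {n m : nat}.
Variables (W : set 'rV[R]_n) (X : 'rV[R]_n -> 'rV[R]_m).
Hypothesis Wo : open W.
Hypothesis XI : smooth_immersion W X.
Implicit Types (F H : 'rV[R]_n -> R) (i j : 'I_n) (k : 'I_m) (u v : 'rV[R]_n).

Lemma coordfE k u : coordf X k u = X u ord0 k.
Proof. by rewrite coordf.unlock. Qed.

Lemma coordf_funE k : coordf X k = fun u => X u ord0 k.
Proof. by rewrite coordf.unlock. Qed.

Lemma invgE i j u : invg X i j u = invmx (metric X u) i j.
Proof. by rewrite invg.unlock. Qed.

Lemma lap_laplacian F u : lap X F u = laplacian X F u.
Proof.
rewrite lap.unlock /laplacian vol.unlock; congr (_ * _); apply: eq_bigr => i _.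
rewrite pdE; congr (partial i _ u : R); apply/funext => v; congr (_ * _).
by apply: eq_bigr => j _; rewrite invgE pdE.
Qed.

Let smX : smooth_on W X := XI.1.

Lemma smooth_coordf k : smooth_on W (coordf X k).
Proof. by rewrite coordf_funE; exact: smooth_coord. Qed.

Let dX u : W u -> differentiable X u. Proof. exact: (smX [::]). Qed.

Lemma jacobianE u i k : W u -> 'J X u i k = pd i (coordf X k) u.
Proof. by move=> uW; rewrite coordf_funE; apply: jacobian_coord; apply: dX. Qed.

Lemma metricE u i j : W u ->
  metric X u i j = \sum_k pd i (coordf X k) u * pd j (coordf X k) u.
Proof.
move=> uW; rewrite mxE; apply: eq_bigr => k _.
by rewrite [X in _ * X]mxE !jacobianE.
Qed.

Lemma smooth_metric i j : smooth_on W (fun v => metric X v i j).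
Proof.
apply: (eq_smooth Wo (F := fun v =>
   \sum_k pd i (coordf X k) v * pd j (coordf X k) v)).
  by move=> v; rewrite inE => vW; rewrite metricE.
apply: (smooth_sum Wo) => k.
by apply: (smoothM Wo); apply: smooth_partial; apply: smooth_coordf.
Qed.

Lemma metric_tr u : (metric X u)^T = metric X u.
Proof. by rewrite /metric trmx_mul trmxK. Qed.

Lemma det_metric_gt0 u : W u -> 0 < \det (metric X u).
Proof. by move=> uW; apply: det_gram_gt0; apply: XI.2. Qed.

Lemma metric_unit u : W u -> metric X u \in unitmx.
Proof. by move=> uW; rewrite unitmxE unitfE gt_eqF// det_metric_gt0. Qed.

Lemma smooth_invg i j : smooth_on W (invg X i j).
Proof.
rewrite invg.unlock; apply: (smooth_invmx Wo); first exact: smooth_metric.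
exact: metric_unit.
Qed.

Lemma vol_gt0 u : W u -> 0 < vol X u.
Proof. by move=> uW; rewrite vol.unlock sqrtr_gt0 det_metric_gt0. Qed.

Lemma smooth_vol : smooth_on W (vol X).
Proof.
rewrite vol.unlock; apply: (smooth_sqrt Wo); last exact: det_metric_gt0.
by apply: (smooth_det Wo) => i j; apply: smooth_metric.
Qed.

Lemma invg_sym u i j : invg X i j u = invg X j i u.
Proof. by rewrite !invgE -[in RHS]metric_tr -trmx_inv [RHS]mxE. Qed.

Lemma sum_invg_metric u i l : W u ->
  \sum_j invg X i j u * metric X u j l = (i == l)%:R.
Proof.
move=> uW; have /matrixP/(_ i l) := mulVmx (metric_unit uW).
by rewrite !mxE => <-; apply: eq_bigr => j _; rewrite invgE.
Qed.

End Immersion.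

(** * The Laplacian *)

(* Abstracting the values at [u] spares [ring] the comparison of derivatives up to
   conversion. *)
Ltac ring_at u :=
  repeat match goal with |- context[?F u] =>
    lazymatch type of (F u) with Real.sort _ => generalize (F u) end
  end; intros; ring.

Section Laplacian.
Context {R : realType} {n m : nat}.
Variables (W : set 'rV[R]_n) (X : 'rV[R]_n -> 'rV[R]_m).
Hypothesis Wo : open W.
Hypothesis XI : smooth_immersion W X.
Implicit Types (F H : 'rV[R]_n -> R) (i j l : 'I_n) (k : 'I_m) (u v : 'rV[R]_n).

Local Notation x := (coordf X).
Local Notation g := (invg X).
Local Notation w := (vol X).
Local Notation Lap := (lap X).
Local Notation Gam := (grad_dot X).
Local Notation beta := (lap_drift X).

Let smg i j : smooth_on W (g i j). Proof. exact: (smooth_invg Wo XI). Qed.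
Let smw : smooth_on W w. Proof. exact: (smooth_vol Wo XI). Qed.
Let smx k : smooth_on W (x k). Proof. exact: (smooth_coordf Wo XI). Qed.
Let df F u : smooth_on W F -> W u -> differentiable F u.
Proof. exact: smooth_differentiable. Qed.

(** The divergence form expanded. In this form the Laplacian at [u] is a linear expression in the
    derivatives at [u], and the rules below become algebra. *)
Lemma lapE F u : smooth_on W F -> W u ->
  Lap F u = \sum_i \sum_j g i j u * pd i (pd j F) u +
            \sum_j beta j u * pd j F u.
Proof.
move=> sF uW.
have smwg i j : smooth_on W (fun v => w v * g i j v) by exact: (smoothM Wo).
have Ei i : pd i (fun v => w v * \sum_j g i j v * pd j F v) u =
  \sum_j (w u * g i j u * pd i (pd j F) u +
          pd j F u * pd i (fun v => w v * g i j v) u).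
  rewrite (eq_partial Wo i (G := fun v => \sum_j (w v * g i j v) * pd j F v));
    last by rewrite inE.
    rewrite partial_sum => [|j].
      apply: eq_bigr => j _; rewrite partialM//; apply: df => //.
      exact: smooth_partial.
    by apply: df => //; apply: (smoothM Wo) => //; apply: smooth_partial.
  by move=> v _; rewrite mulr_sumr; apply: eq_bigr => j _; rewrite mulrA.
have w0 : w u != 0 by rewrite gt_eqF// (vol_gt0 XI).
transitivity ((w u)^-1 *
  \sum_i pd i (fun v => w v * \sum_j g i j v * pd j F v) u).
  by rewrite lap.unlock.
under eq_bigr do rewrite Ei big_split /=.
rewrite big_split /= mulrDr; congr (_ + _).
  rewrite mulr_sumr; apply: eq_bigr => i _; rewrite mulr_sumr.
  by apply: eq_bigr => j _; rewrite -mulrA mulKf.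
rewrite exchange_big mulr_sumr; apply: eq_bigr => j _.
by rewrite -mulr_sumr lap_drift.unlock mulrCA mulrC.
Qed.

Lemma smooth_lap_drift j : smooth_on W (beta j).
Proof.
rewrite lap_drift.unlock; apply: (smoothM Wo).
  by apply: (smoothV Wo) => // u uW; rewrite gt_eqF// (vol_gt0 XI).
apply: (smooth_sum Wo) => i; apply: smooth_partial; exact: (smoothM Wo).
Qed.

Lemma smooth_lap F : smooth_on W F -> smooth_on W (Lap F).
Proof.
move=> sF; apply: (eq_smooth Wo (F := fun u =>
  \sum_i \sum_j g i j u * pd i (pd j F) u +
            \sum_j beta j u * pd j F u)).
  by move=> u; rewrite inE => uW; rewrite lapE.
apply: (smoothD Wo); apply: (smooth_sum Wo) => i.
  apply: (smooth_sum Wo) => j; apply: (smoothM Wo) => //.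
  by do 2!apply: smooth_partial.
by apply: (smoothM Wo); [exact: smooth_lap_drift|exact: smooth_partial].
Qed.

Lemma eq_lap F H u : smooth_on W F -> {in W, F =1 H} -> W u -> Lap F u = Lap H u.
Proof.
move=> sF FH uW; have sH := eq_smooth Wo FH sF.
have FHi i := eq_partial Wo i FH.
have uW' : u \in W by rewrite inE.
rewrite (lapE sF uW) (lapE sH uW); apply: f_equal2; apply: eq_bigr => i _.
  apply: eq_bigr => j _; apply: f_equal.
  by apply: (eq_partial Wo) => // v vW; apply: FHi.
by rewrite FHi.
Qed.

Lemma grad_dotC F H u : Gam F H u = Gam H F u.
Proof.
rewrite grad_dot.unlock exchange_big; apply: eq_bigr => i _; apply: eq_bigr => j _.
by rewrite invg_sym mulrAC.
Qed.

Lemma lapM F H u : smooth_on W F -> smooth_on W H -> W u ->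
  Lap (fun v => F v * H v) u = F u * Lap H u + H u * Lap F u + 2 * Gam F H u.
Proof.
move=> sF sH uW; have sFH := smoothM Wo sF sH.
have uW' : u \in W by rewrite inE.
have E1 j v : W v -> pd j (fun v => F v * H v) v =
    F v * pd j H v + H v * pd j F v.
  by move=> vW; rewrite partialM//; apply: df.
have sP j (G : 'rV[R]_n -> R) : smooth_on W G -> smooth_on W (pd j G) by exact: smooth_partial.
have E2 i j : pd i (pd j (fun v => F v * H v)) u =
    F u * pd i (pd j H) u + H u * pd i (pd j F) u +
    (pd i F u * pd j H u + pd i H u * pd j F u).
  rewrite (eq_partial Wo i (G := fun v => F v * pd j H v + H v * pd j F v))//.
    have [dF dH] := (df sF uW, df sH uW).
    have [dPF dPH] := (df (sP j _ sF) uW, df (sP j _ sH) uW).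
    rewrite partialD; [|exact: (df (smoothM Wo sF (sP j _ sH)) uW)
                       |exact: (df (smoothM Wo sH (sP j _ sF)) uW)].
    rewrite (partialM _ dF dPH).
    rewrite (partialM _ dH dPF).
    ring_at u.
  by move=> v; rewrite inE => vW; apply: E1.
pose A G := \sum_i \sum_j g i j u * pd i (pd j G) u.
pose B G := \sum_j beta j u * pd j G u.
have EA : A (fun v => F v * H v) = F u * A H + H u * A F + (Gam F H u + Gam H F u).
  rewrite /A grad_dot.unlock !mulr_sumr -!big_split; apply: eq_bigr => i _ /=.
  rewrite !mulr_sumr -!big_split; apply: eq_bigr => j _ /=.
  by rewrite E2; ring_at u.
have EB : B (fun v => F v * H v) = F u * B H + H u * B F.
  rewrite /B !mulr_sumr -big_split; apply: eq_bigr => j _ /=.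
  by rewrite E1//; ring_at u.
have LE G : smooth_on W G -> Lap G u = A G + B G by move=> sG; exact: lapE.
rewrite (LE _ sF) (LE _ sH) (LE _ sFH) EA EB.
rewrite (grad_dotC H F); move: (A F) (A H) (B F) (B H) => *; ring_at u.
Qed.

Lemma lap_sum (I : Type) (r : seq I) (P : pred I) (F : I -> 'rV[R]_n -> R) u :
  (forall a, smooth_on W (F a)) -> W u ->
  Lap (fun v => \sum_(a <- r | P a) F a v) u = \sum_(a <- r | P a) Lap (F a) u.
Proof.
move=> sF uW; rewrite (lapE _ uW); last exact: (smooth_sum Wo).
have uW' : u \in W by rewrite inE.
have E1 j v : v \in W -> pd j (fun v => \sum_(a <- r | P a) F a v) v =
    \sum_(a <- r | P a) pd j (F a) v.
  by rewrite inE => vW; rewrite partial_sum// => a; apply: df.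
rewrite [RHS](eq_bigr (fun a => \sum_i \sum_j g i j u * pd i (pd j (F a)) u +
    \sum_j beta j u * pd j (F a) u)); last by move=> a _; exact: lapE.
rewrite big_split /=; apply: f_equal2.
  rewrite [RHS]exchange_big /=; apply: eq_bigr => i _.
  rewrite [RHS]exchange_big /=; apply: eq_bigr => j _.
  rewrite (eq_partial Wo i (E1 j) uW') partial_sum ?mulr_sumr//.
  by move=> a; apply: (df _ uW); apply: smooth_partial.
rewrite [RHS]exchange_big /=; apply: eq_bigr => j _.
by rewrite (E1 _ _ uW') mulr_sumr.
Qed.

Lemma lapZ (c : R) F u : smooth_on W F -> W u ->
  Lap (fun v => c * F v) u = c * Lap F u.
Proof.
move=> sF uW; rewrite (lapM (smooth_cst Wo c) sF uW).
have -> : Lap (fun=> c) u = 0.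
  rewrite (lapE _ uW); last exact: (smooth_cst Wo).
  have E1 j : pd j (fun=> c : R) =1 fun=> 0 by move=> v; apply: partial_cst.
  rewrite big1 ?add0r => [|i _].
    by rewrite big1// => j _; rewrite E1 mulr0.
  rewrite big1// => j _; rewrite (_ : pd j _ = fun=> 0) ?partial_cst ?mulr0//.
  exact/funext/E1.
have -> : Gam (fun=> c) F u = 0.
  rewrite grad_dot.unlock big1// => i _; rewrite big1// => j _.
  by rewrite partial_cst mulr0 mul0r.
by rewrite !mulr0 !addr0.
Qed.

End Laplacian.

(** * Beltrami's formula *)

Section Beltrami.
Context {R : realType} {n m : nat}.
Variables (W : set 'rV[R]_n) (X : 'rV[R]_n -> 'rV[R]_m).
Hypothesis Wo : open W.
Hypothesis XI : smooth_immersion W X.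
Implicit Types (F H : 'rV[R]_n -> R) (i j l : 'I_n) (k : 'I_m) (u v : 'rV[R]_n).

Local Notation x := (coordf X).
Local Notation g := (invg X).
Local Notation w := (vol X).
Local Notation Lap := (lap X).
Local Notation Gam := (grad_dot X).
Local Notation beta := (lap_drift X).

Let smg i j : smooth_on W (g i j). Proof. exact: (smooth_invg Wo XI). Qed.
Let smw : smooth_on W w. Proof. exact: (smooth_vol Wo XI). Qed.
Let smx k : smooth_on W (x k). Proof. exact: (smooth_coordf Wo XI). Qed.
Let smm i j : smooth_on W (fun v => metric X v i j).
Proof. exact: (smooth_metric Wo XI). Qed.
Let smp i F : smooth_on W F -> smooth_on W (pd i F).
Proof. exact: smooth_partial. Qed.
Let df F u : smooth_on W F -> W u -> differentiable F u.
Proof. exact: smooth_differentiable. Qed.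

(** The inner product of [X_ij] and [X_l], which is the Christoffel symbol of the first kind. *)
Let h u i j l := \sum_k pd i (pd j (x k)) u * pd l (x k) u.

Let hC u i j l : W u -> h u i j l = h u j i l.
Proof.
by move=> uW; apply: eq_bigr => k _; rewrite (partialC Wo i j (smx k) uW).
Qed.

Let partial_metric u i j l : W u ->
  pd i (fun v => metric X v j l) u = h u i j l + h u i l j.
Proof.
move=> uW; have uW' : u \in W by rewrite inE.
rewrite (eq_partial Wo i (G := fun v => \sum_k pd j (x k) v * pd l (x k) v) _ uW');
  last by move=> v; rewrite inE => vW; apply: (metricE XI).
rewrite partial_sum; last first.
  by move=> k; apply: (df _ uW); apply: (smoothM Wo); apply: smp.
rewrite /h -big_split; apply: eq_bigr => k _ /=.
rewrite (partialM _ (df (smp _ (smx k)) uW) (df (smp _ (smx k)) uW)).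
ring_at u.
Qed.

(** By Jacobi's formula this is half the trace of the inverse metric times the derivative of the
    metric. The two terms of [partial_metric] contribute equally by symmetry, which absorbs the
    half. *)
Lemma partial_vol u l : W u ->
  (w u)^-1 * pd l w u = \sum_i \sum_j g i j u * h u l i j.
Proof.
move=> uW; have d0 := det_metric_gt0 XI uW.
have sd : smooth_on W (fun v => \det (metric X v)) by exact: (smooth_det Wo).
have -> : pd l w u = (2 * w u)^-1 * pd l (fun v => \det (metric X v)) u.
  by rewrite vol.unlock; exact: (partial_sqrt l (df sd uW) d0).
rewrite (partial_det_unit Wo l smm uW (metric_unit XI uW)).
have -> : \det (metric X u) = w u * w u.
  by rewrite -expr2 vol.unlock sqr_sqrtr// ltW.
have w0 : w u != 0 by rewrite gt_eqF// (vol_gt0 XI).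
set S := \sum_a _.
have -> : (w u)^-1 * ((2 * w u)^-1 * (w u * w u * S)) = S / 2.
  by move: (w u) w0 => a a0; field; rewrite a0.
have -> : S = (\sum_i \sum_j g i j u * h u l i j) + \sum_i \sum_j g i j u * h u l j i.
  rewrite /S -big_split; apply: eq_bigr => i _ /=.
  rewrite -big_split; apply: eq_bigr => j _ /=.
  by rewrite partial_metric// mulrDr -invgE invg_sym.
have E : \sum_i \sum_j g i j u * h u l j i = \sum_i \sum_j g i j u * h u l i j.
  rewrite [LHS]exchange_big /=; apply: eq_bigr => i _; apply: eq_bigr => j _.
  by rewrite invg_sym.
rewrite [X in (_ + X) / _]E.
by move: (\sum_i _) => a; field.
Qed.

(** The tangential part of [Lap X] is the trace of the Christoffel symbols plus the drift lowered by
    the metric; the two cancel by the symmetry of [h] in its first two indices. *)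
Lemma lap_coordf_normal u l : W u -> \sum_k Lap (x k) u * pd l (x k) u = 0.
Proof.
move=> uW; have uW' : u \in W by rewrite inE.
have w0 : w u != 0 by rewrite gt_eqF// (vol_gt0 XI).
transitivity (\sum_i \sum_j g i j u * h u i j l + \sum_j beta j u * metric X u j l).
  rewrite (eq_bigr (fun k =>
    (\sum_i \sum_j g i j u * (pd i (pd j (x k)) u * pd l (x k) u)) +
     \sum_j beta j u * (pd j (x k) u * pd l (x k) u))) => [|k _]; last first.
    rewrite (lapE Wo XI (smx k) uW) mulrDl !mulr_suml; apply: f_equal2.
      apply: eq_bigr => i _; rewrite mulr_suml; apply: eq_bigr => j _.
      by rewrite mulrA.
    by apply: eq_bigr => j _; rewrite mulrA.
  rewrite big_split /=; apply: f_equal2.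
    rewrite exchange_big /=; apply: eq_bigr => i _.
    rewrite exchange_big /=; apply: eq_bigr => j _.
    by rewrite -mulr_sumr.
  rewrite exchange_big /=; apply: eq_bigr => j _.
  by rewrite -mulr_sumr (metricE XI).
have swg i j : smooth_on W (fun v => w v * g i j v) by exact: (smoothM Wo).
(* Obtained by differentiating [\sum_j (w g^ij) g_jl = delta_il w] along coordinate [i] and summing
   over [i]; no derivative of the inverse metric is computed. *)
have Eb : \sum_j beta j u * metric X u j l =
    (w u)^-1 * pd l w u - \sum_i \sum_j g i j u * (h u i j l + h u i l j).
  have Ei i : \sum_j pd i (fun v => w v * g i j v) u * metric X u j l =
      (i == l)%:R * pd l w u - w u * \sum_j g i j u * (h u i j l + h u i l j).
    have <- : pd i (fun v => \sum_j (w v * g i j v) * metric X v j l) u =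
        (i == l)%:R * pd l w u.
      rewrite (eq_partial Wo i (G := fun v => (i == l)%:R * w v) _ uW').
        rewrite partialM; [|exact: differentiable_cst|exact: df].
        rewrite (partial_cst (i == l)%:R i u) mulr0 addr0.
        by case: (i =P l) => [->|_]; rewrite // !mulr0n !mul0r.
      move=> v; rewrite inE => vW; rewrite -(sum_invg_metric XI i l vW) mulr_suml.
      by apply: eq_bigr => j _; rewrite -mulrA mulrC.
    rewrite partial_sum; last first.
      by move=> j; apply: (df _ uW); apply: (smoothM Wo).
    rewrite mulr_sumr -sumrB; apply: eq_bigr => j _.
    rewrite (partialM _ (df (swg i j) uW) (df (smm j l) uW)) partial_metric//.
    by ring_at u.
  rewrite (eq_bigr (fun j => (w u)^-1 *
     \sum_i pd i (fun v => w v * g i j v) u * metric X u j l)); last first.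
    by move=> j _; rewrite lap_drift.unlock -mulrA mulr_suml.
  rewrite -mulr_sumr exchange_big /= (eq_bigr _ (fun i _ => Ei i)) sumrB mulrBr.
  apply: f_equal2.
    rewrite (bigD1 l)//= eqxx mulr1n mul1r big1 ?addr0// => i /negbTE ->.
    by rewrite mulr0n mul0r.
  by rewrite -mulr_sumr mulKf.
rewrite Eb (partial_vol l uW).
rewrite addrA -big_split -sumrB big1// => i _ /=.
rewrite -big_split -sumrB big1// => j _ /=.
by rewrite (hC i l j uW); ring_at u.
Qed.

(* [x] is a row vector, so the tangential projection acts on the right. *)
Definition tangent_proj u : 'M[R]_m := ('J X u)^T *m invmx (metric X u) *m 'J X u.

Lemma grad_dot_coordf k k' u : W u -> Gam (x k) (x k') u = tangent_proj u k k'.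
Proof.
move=> uW; rewrite grad_dot.unlock /tangent_proj [RHS]mxE exchange_big.
apply: eq_bigr => j _ /=; rewrite mxE mulr_suml; apply: eq_bigr => i _.
by rewrite mxE !(jacobianE XI)// -invgE [_ * invg _ _ _ _]mulrC.
Qed.

Lemma normal_partE u (v : 'rV[R]_m) : normal_part X u v = v *m (1%:M - tangent_proj u).
Proof. by rewrite /normal_part /tangent_proj mulmxBr mulmx1 !mulmxA. Qed.

(** [Lap X] is the metric trace [S] of the second derivatives plus a tangent drift term. Being
    normal itself, it equals the normal part of [S]. *)
Lemma mean_curvature_coord k u : W u ->
  mean_curvature_vector X u ord0 k = n%:R^-1 * Lap (x k) u.
Proof.
move=> uW; have uW' : u \in W by rewrite inE.
pose eta : 'rV[R]_m := \row_k Lap (x k) u.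
pose S : 'rV[R]_m := \sum_i \sum_j invmx (metric X u) i j *: partial i (partial j X) u.
have -> : mean_curvature_vector X u = n%:R^-1 *: (S *m (1%:M - tangent_proj u)).
  rewrite /mean_curvature_vector /S mulmx_suml; congr (_ *: _).
  apply: eq_bigr => i _; rewrite mulmx_suml; apply: eq_bigr => j _.
  by rewrite /second_fundamental_form normal_partE scalemxAl.
have dX v : W v -> differentiable X v by exact: (XI.1 [::]).
have dpX j v : W v -> differentiable (partial j X) v by exact: (XI.1 [:: j]).
have HS : eta = S + (\row_j beta j u) *m 'J X u.
  apply/rowP => k'; rewrite !mxE (lapE Wo XI (smx k') uW); apply: f_equal2.
    rewrite summxE; apply: eq_bigr => i _; rewrite summxE; apply: eq_bigr => j _.
    rewrite mxE invgE; congr (_ * _); rewrite -(partial_coord i k' (dpX j u uW)).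
    apply: (eq_partial Wo) => // v; rewrite inE => vW.
    by rewrite -(partial_coord j k' (dX v vW)) coordf_funE.
  by apply: eq_bigr => j _; rewrite mxE (jacobianE XI).
have HJ : 'J X u *m (1%:M - tangent_proj u) = 0.
  rewrite mulmxBr mulmx1 /tangent_proj !mulmxA -/(metric X u).
  by rewrite mulmxV ?(metric_unit XI)// mul1mx subrr.
have HN : eta *m ('J X u)^T = 0.
  apply/rowP => l; rewrite !mxE -[RHS](lap_coordf_normal l uW).
  by apply: eq_bigr => k' _; rewrite !mxE -(jacobianE XI l k' uW) mxE.
have -> : S *m (1%:M - tangent_proj u) = eta.
  have -> : S = eta - (\row_j beta j u) *m 'J X u by rewrite HS addrK.
  rewrite mulmxBl -mulmxA HJ mulmx0 subr0 mulmxBr mulmx1 /tangent_proj !mulmxA HN.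
  by rewrite !mul0mx subr0.
by rewrite !mxE.
Qed.

(** In codimension one the normal space is the line of [v]. The complementary projection is
    symmetric, has its rows in that line and fixes [v], which determines it. *)
Lemma tangent_proj_normal u (v : 'rV[R]_m) : n.+1 = m -> W u -> v != 0 ->
  v *m ('J X u)^T = 0 ->
  tangent_proj u = 1%:M - ((v *m v^T) ord0 ord0)^-1 *: (v^T *m v).
Proof.
move=> nm uW v0 vJ; set P := tangent_proj u; set s := (_ *m _) _ _.
set J := 'J X u in vJ; pose Q := 1%:M - P.
have Jf : row_free J by exact: XI.2.
have QJ : Q *m J^T = 0.
  rewrite mulmxBl mul1mx /P /tangent_proj -/J -[_ *m J *m J^T]mulmxA.
  rewrite -[J *m J^T]/(metric X u).
  by rewrite -mulmxA mulVmx ?(metric_unit XI)// mulmx1 subrr.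
have PT : P^T = P by rewrite /P /tangent_proj !trmx_mul trmxK trmx_inv metric_tr mulmxA.
have QT : Q^T = Q by rewrite /Q linearB /= trmx1 PT.
have vK : (v <= kermx J^T)%MS by apply/sub_kermxP.
have rK : \rank (kermx J^T) = 1%N by rewrite mxrank_ker mxrank_tr (eqP Jf) -nm subSnn.
have Kv : (kermx J^T <= v)%MS by rewrite -(mxrank_leqif_sup vK).2 rK rank_rV v0.
have /submxP[D QD] : (Q <= v)%MS by apply: submx_trans Kv; apply/sub_kermxP.
have vQ : v *m Q = v.
  by rewrite mulmxBr mulmx1 /P /tangent_proj !mulmxA vJ !mul0mx subr0.
have : Q *m v^T = v^T by rewrite -{1}QT -trmx_mul vQ.
rewrite QD -mulmxA (mx11_scalar (v *m v^T)) mul_mx_scalar -/s => sD.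
have s0 : s != 0 by rewrite gt_eqF// sqr_norm_gt0.
have DE : D = s^-1 *: v^T by rewrite -sD scalerA mulVf// scale1r.
by rewrite -[LHS](subKr 1%:M) -/Q QD DE -scalemxAl.
Qed.

End Beltrami.

(** * Derivation along a vector field *)

HB.lock Definition vfd (R : realType) (n : nat) (e : 'I_n -> 'rV[R]_n -> R)
    (F : 'rV[R]_n -> R) (u : 'rV[R]_n) : R := \sum_i e i u * pd i F u.

Lemma vfdE (R : realType) (n : nat) (e : 'I_n -> 'rV[R]_n -> R) F u :
  vfd e F u = \sum_i e i u * pd i F u.
Proof. by rewrite vfd.unlock. Qed.

Section VectorField.
Context {R : realType} {n : nat}.
Variables (W : set 'rV[R]_n) (e : 'I_n -> 'rV[R]_n -> R).
Hypothesis Wo : open W.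
Hypothesis se : forall i, smooth_on W (e i).
Implicit Types (F G : 'rV[R]_n -> R) (u : 'rV[R]_n).

Local Notation D := (vfd e).

Lemma smooth_vfd F : smooth_on W F -> smooth_on W (D F).
Proof.
move=> sF; rewrite vfd.unlock; apply: (smooth_sum Wo) => i.
by apply: (smoothM Wo) => //; apply: smooth_partial.
Qed.

Lemma eq_vfd F G u : {in W, F =1 G} -> W u -> D F u = D G u.
Proof.
move=> FG uW; rewrite vfd.unlock; apply: eq_bigr => i _.
by rewrite (eq_partial Wo i FG)// inE.
Qed.

Lemma vfd_cst (c : R) u : D (fun=> c) u = 0.
Proof. by rewrite vfd.unlock big1// => i _; rewrite (partial_cst c i u) mulr0. Qed.

Lemma vfdD F G u : smooth_on W F -> smooth_on W G -> W u ->
  D (fun v => F v + G v) u = D F u + D G u.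
Proof.
move=> sF sG uW; rewrite vfd.unlock -big_split; apply: eq_bigr => i _ /=.
by rewrite partialD ?mulrDr//; exact: (smooth_differentiable _ uW).
Qed.

Lemma vfdN F u : smooth_on W F -> W u -> D (fun v => - F v) u = - D F u.
Proof.
move=> sF uW; rewrite vfd.unlock -sumrN; apply: eq_bigr => i _ /=.
by rewrite partialN ?mulrN//; exact: (smooth_differentiable _ uW).
Qed.

Lemma vfdB F G u : smooth_on W F -> smooth_on W G -> W u ->
  D (fun v => F v - G v) u = D F u - D G u.
Proof. by move=> sF sG uW; rewrite vfdD ?vfdN//; apply: (smoothN Wo). Qed.

Lemma vfdM F G u : smooth_on W F -> smooth_on W G -> W u ->
  D (fun v => F v * G v) u = F u * D G u + G u * D F u.
Proof.
move=> sF sG uW; rewrite vfd.unlock !mulr_sumr -big_split; apply: eq_bigr => i _ /=.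
rewrite (partialM _ (smooth_differentiable sF uW) (smooth_differentiable sG uW)).
by rewrite mulrDr !(mulrCA (e i u)).
Qed.

Lemma vfdV F u : smooth_on W F -> W u -> F u != 0 ->
  D (fun v => (F v)^-1) u = - (F u) ^- 2 * D F u.
Proof.
move=> sF uW F0; rewrite vfd.unlock !mulr_sumr; apply: eq_bigr => i _ /=.
by rewrite (partialV _ (smooth_differentiable sF uW) F0) mulrCA.
Qed.

Lemma smooth_horner (p : {poly R}) F : smooth_on W F ->
  smooth_on W (fun v => p.[F v]).
Proof.
move=> sF; elim/poly_ind: p => [|p c IH].
  by under eq_fun do rewrite horner0; apply: (smooth_cst Wo).
under eq_fun do rewrite hornerMXaddC.
by apply: (smoothD Wo); [apply: (smoothM Wo)|apply: (smooth_cst Wo)].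
Qed.

Lemma vfd_horner (p : {poly R}) F u : smooth_on W F -> W u ->
  D (fun v => p.[F v]) u = p^`().[F u] * D F u.
Proof.
move=> sF uW; elim/poly_ind: p => [|p c IH].
  rewrite deriv0 horner0 mul0r -[RHS](vfd_cst 0 u).
  by apply: eq_vfd uW => v _; rewrite horner0.
rewrite (eq_vfd (G := fun v => p.[F v] * F v + c) _ uW) => [|v _]; last first.
  by rewrite hornerMXaddC.
have sp := smooth_horner p sF.
rewrite (vfdD (smoothM Wo sp sF) (smooth_cst Wo c) uW) (vfdM sp sF uW) vfd_cst.
rewrite IH derivMXaddC hornerD hornerMX.
by move: (vfd _ _ _) (F u) => d f; ring.
Qed.

End VectorField.

Lemma smooth_on_subset (R : realType) (n : nat) (V : normedModType R)
    (W W' : set 'rV[R]_n) (F : 'rV[R]_n -> V) :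
  W' `<=` W -> smooth_on W F -> smooth_on W' F.
Proof. by move=> WW sF s u uW; apply/sF/WW. Qed.

Lemma open_nonzero (R : realType) (n : nat) (W : set 'rV[R]_n) (F : 'rV[R]_n -> R) :
  open W -> smooth_on W F -> open (W `&` [set u | F u != 0]).
Proof.
move=> Wo sF; rewrite openE => u [uW F0].
have cF : {for u, continuous F} by exact: (smooth_continuous sF).
apply: filterI; first exact: open_nbhs_nbhs.
have : \forall y \near F u, y != 0.
  by apply: open_nbhs_nbhs; split => //; exact: open_neq.
exact: cF.
Qed.

(** Differentiating [p(F) = 0] gives [p'(F) * D F = 0]. So where [D F] is nonzero, an open set, [F]
    is a root of [p'], and induction on the degree applies there. *)
Lemma vfd_algebraic (R : realType) (n : nat) (W : set 'rV[R]_n)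
    (e : 'I_n -> 'rV[R]_n -> R) (p : {poly R}) (F : 'rV[R]_n -> R) :
  open W -> (forall i, smooth_on W (e i)) -> smooth_on W F -> p != 0 ->
  (forall u, W u -> p.[F u] = 0) -> forall u, W u -> vfd e F u = 0.
Proof.
elim: {p}(size p) {-2}p (leqnn (size p)) W => [|k IH] p; first by
  rewrite leqn0 size_poly_eq0 => /eqP -> W _ _ _; rewrite eqxx.
move=> sp W Wo se sF p0 pF u uW; apply/eqP; rewrite -[_ == _]negbK; apply/negP => DF0.
have sDF := smooth_vfd Wo se sF.
pose W' := W `&` [set v | vfd e F v != 0].
have W'W : W' `<=` W by move=> v [].
have W'o : open W' by exact: open_nonzero.
have sub G : smooth_on W G -> smooth_on W' G by exact: smooth_on_subset.
have p'F v : W' v -> p^`().[F v] = 0.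
  move=> [vW Dv]; apply/eqP; rewrite -(mulIr_eq0 _ (mulIf Dv)) -(vfd_horner e Wo p sF vW) //.
  rewrite (eq_vfd e Wo (G := fun=> 0) _ vW) ?vfd_cst// => w.
  by rewrite inE => wW; apply: pF.
(* In characteristic 0 a zero derivative makes [p] a nonzero constant, which has no root. *)
have [p'0|p'0] := eqVneq p^`() 0.
  have : (size p <= 1)%N.
    rewrite leqNgt; apply/negP => s1; have := lead_coef_eq0 p.
    rewrite (negbTE p0) lead_coefE; have := coef_deriv p (size p).-2.
    rewrite p'0 coef0 prednK; last by rewrite -subn1 subn_gt0.
    by move/esym/eqP; rewrite mulrn_eq0 -{1}subn1 subn_eq0 leqNgt s1 /= => ->.
  move=> /size1_polyC pc; have := pF u uW; rewrite pc hornerC => c0.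
  by rewrite pc c0 eqxx in p0.
have sp' : (size p^`() <= k)%N by rewrite -ltnS (leq_trans (lt_size_deriv p0)).
have D0 := IH p^`() sp' W' W'o (fun i => sub _ _ (se i)) (sub _ _ sF) p'0 p'F u
  (conj uW DF0).
by rewrite D0 eqxx in DF0.
Qed.

(** * The equations of the profile curve *)

Ltac smooth_rec Wo :=
  first
  [ assumption
  | lazymatch goal with
    | |- smooth_on _ (fun v => @?F v + @?G v) =>
        apply: (@smoothD _ _ _ Wo F G); smooth_rec Wo
    | |- smooth_on _ (fun v => - @?F v) =>
        apply: (@smoothN _ _ _ Wo F); smooth_rec Wo
    | |- smooth_on _ (fun v => @?F v * @?G v) =>
        apply: (@smoothM _ _ _ Wo F G); smooth_rec Wo
    | |- smooth_on _ (fun v => (@?F v)^-1) =>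
        apply: (@smoothV _ _ _ Wo F); [smooth_rec Wo | try assumption]
    | |- smooth_on ?W (fun v => vfd ?e ?F v) =>
        change (smooth_on W (vfd e F)); smooth_rec Wo
    | |- smooth_on _ (fun _ => ?c) => exact: (smooth_cst Wo c)
    | |- smooth_on _ (vfd _ ?F) =>
        apply: (smooth_vfd Wo); [assumption | smooth_rec Wo]
    end ].

Ltac eta_reduce F := lazymatch F with (fun v => ?f v) => f | _ => F end.

Ltac vfd_rec Wo uW :=
  lazymatch type of uW with ?W ?u =>
  repeat (cbv beta; match goal with
  | |- context[vfd ?e (fun v => @?F v - @?G v) u] =>
     let F := eta_reduce F in let G := eta_reduce G in
     rewrite (@vfdB _ _ W e Wo F G u); [|smooth_rec Wo|smooth_rec Wo|exact: uW]
  | |- context[vfd ?e (fun v => @?F v + @?G v) u] =>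
     let F := eta_reduce F in let G := eta_reduce G in
     rewrite (@vfdD _ _ W e F G u); [|smooth_rec Wo|smooth_rec Wo|exact: uW]
  | |- context[vfd ?e (fun v => - @?F v) u] =>
     let F := eta_reduce F in
     rewrite (@vfdN _ _ W e F u); [|smooth_rec Wo|exact: uW]
  | |- context[vfd ?e (fun v => @?F v * @?G v) u] =>
     let F := eta_reduce F in let G := eta_reduce G in
     rewrite (@vfdM _ _ W e F G u); [|smooth_rec Wo|smooth_rec Wo|exact: uW]
  | |- context[vfd ?e (fun v => (@?F v)^-1) u] =>
     let F := eta_reduce F in
     rewrite (@vfdV _ _ W e F u); [|smooth_rec Wo|exact: uW|]
  | |- context[vfd ?e (fun _ => ?c) u] => rewrite (@vfd_cst _ _ e c u)
  end) end.

(* [e] is the unit field tangent to M and normal to the orbits, (a, b) are the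
   components of the unit normal in the directions of the two radii [r] and [s],
   and [k] is the principal curvature in the direction of [e]. *)
Record profile (R : realType) (n : nat) (W : set 'rV[R]_n)
    (e : 'I_n -> 'rV[R]_n -> R) (r s a b k : 'rV[R]_n -> R) : Prop := Profile {
  profile_open : open W;
  profile_field i : smooth_on W (e i);
  profile_r : smooth_on W r;
  profile_s : smooth_on W s;
  profile_a : smooth_on W a;
  profile_b : smooth_on W b;
  profile_k : smooth_on W k;
  profile_r_neq0 u : W u -> r u != 0;
  profile_s_neq0 u : W u -> s u != 0;
  profile_unit u : W u -> a u ^+ 2 + b u ^+ 2 = 1;
  profile_dr u : W u -> vfd e r u = b u;
  profile_ds u : W u -> vfd e s u = - a u;
  profile_da u : W u -> vfd e a u = k u * b u;
  profile_db u : W u -> vfd e b u = - (k u * a u)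
}.

Section Profile.
Context {R : realType} {n : nat}.
Variables (W : set 'rV[R]_n) (e : 'I_n -> 'rV[R]_n -> R).
Variables (r s a b k lam : 'rV[R]_n -> R) (m l : R).
Hypothesis P : profile W e r s a b k.
Hypothesis slam : smooth_on W lam.
Hypothesis lamE : forall u, W u ->
  lam u = - (k u + m * (a u * (r u)^-1) + l * (b u * (s u)^-1)).
Local Notation D := (vfd e).
Let delta u := m * (b u * (r u)^-1) - l * (a u * (s u)^-1).
Hypothesis La : forall u, W u ->
  D (D (fun v => lam v * a v)) u + delta u * D (fun v => lam v * a v) u =
  m * (lam u * a u * (r u) ^- 2).
Hypothesis Lb : forall u, W u ->
  D (D (fun v => lam v * b v)) u + delta u * D (fun v => lam v * b v) u =
  l * (lam u * b u * (s u) ^- 2).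

Let Wo := profile_open P.
Let se := profile_field P.
Let sr := profile_r P.
Let ss := profile_s P.
Let sa := profile_a P.
Let sb := profile_b P.
Let sk := profile_k P.
Let r0 := profile_r_neq0 P.
Let s0 := profile_s_neq0 P.

Lemma profile_dlam u : W u ->
  D lam u = - (D k u + m * (k u * b u / r u - a u * b u / r u ^+ 2)
                    + l * (- (k u * a u) / s u + a u * b u / s u ^+ 2)).
Proof.
move=> uW; rewrite (eq_vfd e Wo (G := fun v =>
  - (k v + m * (a v * (r v)^-1) + l * (b v * (s v)^-1))) _ uW); last first.
  by move=> v; rewrite inE; apply: lamE.
have ru := r0 uW; have su := s0 uW.
vfd_rec Wo uW => //.
rewrite (profile_dr P uW) (profile_ds P uW) (profile_da P uW) (profile_db P uW).
move: (D k u) (r u) (s u) (a u) (b u) (k u) ru su => dk ru su au bu ku ru0 su0.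
by field; rewrite ?ru0 ?su0.
Qed.

Lemma profile_dlama u : W u ->
  D (D (fun v => lam v * a v)) u =
  a u * D (D lam) u + 2 * (k u * b u) * D lam u
  + lam u * (D k u * b u - k u * k u * a u).
Proof.
move=> uW; rewrite (eq_vfd e Wo (G := fun v =>
  lam v * (k v * b v) + a v * D lam v) _ uW); last first.
  move=> v; rewrite inE => vW; vfd_rec Wo vW.
  by rewrite (profile_da P vW).
vfd_rec Wo uW; rewrite (profile_da P uW) (profile_db P uW).
ring_at u.
Qed.

Lemma profile_dlamb u : W u ->
  D (D (fun v => lam v * b v)) u =
  b u * D (D lam) u - 2 * (k u * a u) * D lam u
  - lam u * (D k u * a u + k u * k u * b u).
Proof.
move=> uW; rewrite (eq_vfd e Wo (G := fun v =>
  b v * D lam v - lam v * (k v * a v)) _ uW); last first.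
  move=> v; rewrite inE => vW; vfd_rec Wo vW.
  by rewrite (profile_db P vW); ring_at v.
vfd_rec Wo uW; rewrite (profile_da P uW) (profile_db P uW).
ring_at u.
Qed.

(** This is [a] times [La] plus [b] times [Lb]. The principal curvatures are [k], [a / r] with
    multiplicity [m] and [b / s] with multiplicity [l], so the factor of [lam] is the squared norm
    of the second fundamental form. *)
Lemma profile_normal_eq u : W u ->
  D (D lam) u + delta u * D lam u =
  lam u * (k u ^+ 2 + m * (a u / r u) ^+ 2 + l * (b u / s u) ^+ 2).
Proof.
move=> uW; have ru := r0 uW; have su := s0 uW.
have := La uW; have := Lb uW.
rewrite (profile_dlama uW) (profile_dlamb uW).
vfd_rec Wo uW; rewrite (profile_da P uW) (profile_db P uW) => Eb Ea.
have U := profile_unit P uW.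
rewrite -[LHS]mulr1 -[RHS]mulr1 -U.
have -> : (D (D lam) u + delta u * D lam u) * (a u ^+ 2 + b u ^+ 2) =
  a u * (a u * D (D lam) u + 2 * (k u * b u) * D lam u
  + lam u * (D k u * b u - k u * k u * a u) + delta u * (lam u * (k u * b u) + a u * D lam u))
  + b u * (b u * D (D lam) u - 2 * (k u * a u) * D lam u
  - lam u * (D k u * a u + k u * k u * b u) + delta u * (lam u * - (k u * a u) + b u * D lam u))
  + lam u * k u ^+ 2 * (a u ^+ 2 + b u ^+ 2).
  by ring_at u.
rewrite Ea Eb.
move: (lam u) (r u) (s u) (a u) (b u) (k u) U ru su => la ru su au bu ku U ru0 su0.
by rewrite U; field; rewrite ?ru0 ?su0.
Qed.

Lemma profile_tangent_eq u : W u -> (2 * k u - lam u) * D lam u = 0.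
Proof.
move=> uW; have ru := r0 uW; have su := s0 uW.
have := La uW; have := Lb uW.
rewrite (profile_dlama uW) (profile_dlamb uW).
vfd_rec Wo uW; rewrite (profile_da P uW) (profile_db P uW) => Eb Ea.
have U := profile_unit P uW.
(* This is [b] times [La] minus [a] times [Lb]. Once [D k] is eliminated by differentiating the
   formula for [lam], all terms without [D lam] cancel. *)
have E : (b u * a u * (m / r u ^+ 2 - l / s u ^+ 2)) * lam u =
   (2 * k u * D lam u + lam u * (D k u + delta u * k u)) * (a u ^+ 2 + b u ^+ 2).
  transitivity (b u * (m * (lam u * a u * r u ^- 2)) - a u * (l * (lam u * b u * s u ^- 2))).
    move: (lam u) (r u) (s u) (a u) (b u) ru su => la ru su au bu ru0 su0.
    by field; rewrite ?ru0 ?su0.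
  by rewrite -Ea -Eb; ring_at u.
rewrite U mulr1 /delta in E; have F := profile_dlam uW.
have Fk : D k u = - D lam u - m * (k u * b u / r u - a u * b u / r u ^+ 2)
                    - l * (- (k u * a u) / s u + a u * b u / s u ^+ 2).
  by rewrite F; move: (_ / _) (_ / _ ^+ 2) (_ / s u) (_ / s u ^+ 2) => *; ring_at u.
rewrite Fk {Fk F} in E.
move: (D lam u) (lam u) (r u) (s u) (a u) (b u) (k u) ru su E
  => dl la ru su au bu ku ru0 su0 E.
transitivity ((2 * ku * dl +
     la *
     (- dl - m * (ku * bu / ru - au * bu / ru ^+ 2)
      - l * (- (ku * au) / su + au * bu / su ^+ 2) +
      (m * (bu / ru) - l * (au / su)) * ku))
     - bu * au * (m / ru ^+ 2 - l / su ^+ 2) * la).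
  by field; rewrite ?ru0 ?su0.
by rewrite E subrr.
Qed.

End Profile.

(** * Elimination *)

(* Here m = p - 1, l = q - 1, s = (b / |y|) / (a / |x|) and t = (b / a)^2 for the
   normal (a x / |x|, b y / |y|). Up to a nonzero factor, [pol_F] is the normal
   component of biharmonicity when the mean curvature is twice the principal
   curvature k, and [pol_dF] its derivative along the profile curve. Modulo
   [pol_F], the latter is [t * (pol_e1 * t + s * pol_e0)], so that [s * pol_res]
   is the resultant in [t]. *)
Section Elimination.
Context {A : comNzRingType}.
Implicit Types m l s t : A.

Definition pol0 m l s := m + (l + 3) * s.
Definition pol1 m l s := m + 3 + l * s.
Definition polk m l s := m + l * s.
Definition pol_f1 m l s :=
  - (m * m * (m + 6) + m * l * (m + 3) * s + m * l * (l + 3) * (s * s)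
     + l * l * (l + 6) * (s * s * s)).
Definition pol_df1 m l s :=
  - (m * l * (m + 3) + 2 * m * l * (l + 3) * s + 3 * (l * l * (l + 6)) * (s * s)).
Definition pol_f2 m l s := (3 - m) * m * pol1 m l s.
Definition pol_g0 m l s := (3 - l) * l * pol0 m l s.
Definition pol_F m l s t :=
  pol_f2 m l s * (t * t) + pol_f1 m l s * t + s * s * pol_g0 m l s.
Definition pol_dF m l s t :=
  s * (pol0 m l s + t * pol1 m l s) * ((3 - m) * m * l * (t * t) + pol_df1 m l s * t
    + (3 - l) * l * (2 * s * pol0 m l s + s * s * (l + 3)))
  + 2 * polk m l s * t * (1 + t) * (2 * pol_f2 m l s * t + pol_f1 m l s).
Definition pol_e1 m l s :=
  s * ((3 - m) * m * l * pol0 m l s + pol_df1 m l s * pol1 m l s)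
  - (2 * polk m l s + s * l) * pol_f1 m l s - ((9 - l) * s - 2 * m) * pol_f2 m l s.
Definition pol_e0 m l s :=
  pol_df1 m l s * pol0 m l s
  + (3 - l) * l * (2 * s * pol0 m l s + s * s * (l + 3)) * pol1 m l s
  - (l * s * s + 4 * polk m l s * s) * pol_g0 m l s - (l + 9) * pol_f1 m l s.
Definition pol_res m l s :=
  s * pol_f2 m l s * pol_e0 m l s ^+ 2 - pol_f1 m l s * pol_e0 m l s * pol_e1 m l s
  + s * pol_g0 m l s * pol_e1 m l s ^+ 2.

(** The quotient is linear in [t]; its two coefficients are chosen to cancel the cubic and the
    constant term of [pol_dF], so that [t], positive in the application, divides the remainder. *)
Lemma pol_dF_mod m l s t :
  pol_dF m l s t = (4 * polk m l s * (1 + t) + s * l * t + ((9 - l) * s - 2 * m))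
     * pol_F m l s t + t * (pol_e1 m l s * t + s * pol_e0 m l s).
Proof.
rewrite /pol_dF /pol_F /pol_e1 /pol_e0 /pol_f2 /pol_g0 /pol_f1 /pol_df1 /pol0 /pol1 /polk.
by ring.
Qed.

(** A certificate that a common zero of [pol_F] and [pol_e1 * t + s * pol_e0] is a zero of
    [s * pol_res]. It avoids solving for [t], which would divide by [pol_e1]. *)
Lemma pol_resE m l s t :
  s * pol_res m l s = pol_e1 m l s ^+ 2 * pol_F m l s t
  - (pol_e1 m l s * t + s * pol_e0 m l s) *
    (pol_f2 m l s * (pol_e1 m l s * t - s * pol_e0 m l s) + pol_e1 m l s * pol_f1 m l s).
Proof.
rewrite /pol_res /pol_F; move: (pol_f1 _ _ _) (pol_f2 _ _ _) (pol_g0 _ _ _).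
by move: (pol_e1 _ _ _) (pol_e0 _ _ _) => *; ring.
Qed.

(** Positive for [m > 0] and [l >= 0]: the resultant is then a nonzero polynomial in [s]. *)
Lemma pol_res0 m l :
  pol_res m l 0 = 18 * m ^+ 6 * (m + 6) * (l + 3 * m + 18) * (2 * m + 3).
Proof.
rewrite /pol_res /pol_e1 /pol_e0 /pol_f2 /pol_g0 /pol_f1 /pol_df1 /pol0 /pol1 /polk.
by ring.
Qed.

End Elimination.

(** Taking the indeterminate for [s] turns the resultant into a polynomial; evaluation is a ring
    morphism, so its values are the resultants at real [s]. *)
Lemma rmorph_pol_res (A B : comNzRingType) (f : {rmorphism A -> B}) (m l s : A) :
  f (pol_res m l s) = pol_res (f m) (f l) (f s).
Proof.
have fE := (rmorph_nat f, rmorphXn f, rmorphM f, rmorphN f, rmorphB f, rmorphD f).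
have E0 : f (pol0 m l s) = pol0 (f m) (f l) (f s) by rewrite /pol0 !fE.
have E1 : f (pol1 m l s) = pol1 (f m) (f l) (f s) by rewrite /pol1 !fE.
have Ek : f (polk m l s) = polk (f m) (f l) (f s) by rewrite /polk !fE.
have Ef1 : f (pol_f1 m l s) = pol_f1 (f m) (f l) (f s) by rewrite /pol_f1 !fE.
have Ed : f (pol_df1 m l s) = pol_df1 (f m) (f l) (f s) by rewrite /pol_df1 !fE.
have Ef2 : f (pol_f2 m l s) = pol_f2 (f m) (f l) (f s).
  by rewrite /pol_f2 !(E1, fE).
have Eg : f (pol_g0 m l s) = pol_g0 (f m) (f l) (f s) by rewrite /pol_g0 !(E0, fE).
have Ee1 : f (pol_e1 m l s) = pol_e1 (f m) (f l) (f s).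
  by rewrite /pol_e1 !(E0, E1, Ek, Ef1, Ed, Ef2, fE).
have Ee0 : f (pol_e0 m l s) = pol_e0 (f m) (f l) (f s).
  by rewrite /pol_e0 !(E0, E1, Ek, Ef1, Ed, Eg, fE).
by rewrite /pol_res !(Ee1, Ee0, Ef1, Ef2, Eg, fE).
Qed.

Lemma horner_pol_res (R : realType) (m l s : R) :
  (pol_res m%:P l%:P 'X).[s] = pol_res m l s.
Proof.
by rewrite -[LHS]/(horner_eval s _) rmorph_pol_res /= /horner_eval !hornerC hornerX.
Qed.

Lemma profile_subset (R : realType) (n : nat) (W W' : set 'rV[R]_n) e r s a b k :
  open W' -> W' `<=` W -> profile W e r s a b k -> profile W' e r s a b k.
Proof.
by move=> W'o sub [? ? ? ? ? ? ? ? ? ? ? ? ? ?]; split=> *;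
  first [assumption | exact: (smooth_on_subset sub) | auto].
Qed.

(** * The case where the mean curvature is twice the principal curvature *)

Section Nonconstant.
Context {R : realType} {n : nat}.
Variables (W : set 'rV[R]_n) (e : 'I_n -> 'rV[R]_n -> R).
Variables (r s a b k : 'rV[R]_n -> R) (m l : R).
Hypothesis P : profile W e r s a b k.
Hypotheses (m0 : 0 <= m) (l0 : 0 <= l).
Local Notation D := (vfd e).
Hypothesis a0 : forall u, W u -> a u != 0.
Hypothesis b0 : forall u, W u -> b u != 0.
Hypothesis k0 : forall u, W u -> k u != 0.
Hypothesis kE : forall u, W u ->
  3 * k u = - (m * (a u * (r u)^-1) + l * (b u * (s u)^-1)).
Hypothesis Nk : forall u, W u ->
  D (D k) u + (m * (b u / r u) - l * (a u / s u)) * D k u =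
  k u * (k u ^+ 2 + m * (a u / r u) ^+ 2 + l * (b u / s u) ^+ 2).

Let Wo := profile_open P.
Let se := profile_field P.
Let sr := profile_r P.
Let ss := profile_s P.
Let sa := profile_a P.
Let sb := profile_b P.
Let sk := profile_k P.
Let r0 := profile_r_neq0 P.
Let s0 := profile_s_neq0 P.
Let S v := b v * r v * ((a v)^-1 * (s v)^-1).
Let T v := b v * (a v)^-1 * (b v * (a v)^-1).

Let sS : smooth_on W S. Proof. rewrite /S /T; smooth_rec Wo. Qed.
Let sT : smooth_on W T. Proof. rewrite /S /T; smooth_rec Wo. Qed.

Let kE' u : W u -> k u = - (m * (a u / r u) + l * (b u / s u)) / 3.
Proof. by move=> uW; rewrite -kE//; field. Qed.

Let DkE u : W u ->
  D k u = - 3^-1 *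
    (m * (k u * b u * (r u)^-1 - a u * b u * ((r u)^-1 * (r u)^-1))
     + l * (- (k u * a u * (s u)^-1) + a u * b u * ((s u)^-1 * (s u)^-1))).
Proof.
move=> uW; rewrite (eq_vfd e Wo (G := fun v =>
  - 3^-1 * (m * (a v * (r v)^-1) + l * (b v * (s v)^-1))) _ uW); last first.
  by move=> v; rewrite inE => vW; rewrite kE'//; move: (m * _ + _) => z; field.
have ru := r0 uW; have su := s0 uW.
vfd_rec Wo uW => //.
rewrite (profile_dr P uW) (profile_ds P uW) (profile_da P uW) (profile_db P uW).
move: (r u) (s u) (a u) (b u) (k u) ru su => ru su au bu ku ru0 su0.
by field; rewrite ?ru0 ?su0.
Qed.

Lemma profile_pol_F u : W u -> pol_F m l (S u) (T u) = 0.
Proof.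
move=> uW; have := Nk uW.
rewrite (eq_vfd e Wo (G := fun u => - 3^-1 *
    (m * (k u * b u * (r u)^-1 - a u * b u * ((r u)^-1 * (r u)^-1))
     + l * (- (k u * a u * (s u)^-1) + a u * b u * ((s u)^-1 * (s u)^-1)))) _ uW); last first.
  by move=> v; rewrite inE; exact: DkE.
have ru := r0 uW; have su := s0 uW.
vfd_rec Wo uW => //.
rewrite (profile_dr P uW) (profile_ds P uW) (profile_da P uW) (profile_db P uW).
rewrite (DkE uW) (kE' uW) /S /T.
move: (r u) (s u) (a u) (b u) ru su (a0 uW) (b0 uW) => x y c d x0 y0 c0 d0 /eqP.
rewrite -subr_eq0 => /eqP E.
rewrite /pol_F /pol_f2 /pol_f1 /pol_g0 /pol1 /pol0.
(* The factor [(x / c)^3] makes the equation invariant under scaling of the radii. Expressing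
   [1 / s] by [S] brings powers of [b] into the denominators, and [(d / c)^2] clears them. The
   number matches the normalization of [pol_F]. *)
match type of E with ?L = 0 =>
  transitivity (- (27 / 2) * (d * d * x ^+ 3 / (c ^+ 5)) * L) end; last by rewrite E mulr0.
field.
by rewrite ?x0 ?y0 ?c0.
Qed.

(** The common factor of [D S] and [D T]. Up to it, [D] acts on [S] and [T] as a polynomial vector
    field, so differentiating [pol_F] gives again a polynomial in [S] and [T]. *)
Let c u := a u ^+ 2 / (3 * b u * r u).

Let c0 u : W u -> c u != 0.
Proof.
move=> uW; have ru := r0 uW; have au := a0 uW; have bu := b0 uW.
rewrite /c mulf_neq0 ?invr_eq0 ?expf_neq0//.
by rewrite !mulf_neq0 ?pnatr_eq0.
Qed.

Let DS u : W u -> D S u = c u * (S u * (pol0 m l (S u) + T u * pol1 m l (S u))).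
Proof.
move=> uW; have ru := r0 uW; have su := s0 uW; have au := a0 uW.
have -> : D S u = D (fun v => b v * r v * ((a v)^-1 * (s v)^-1)) u by [].
vfd_rec Wo uW => //.
rewrite (profile_dr P uW) (profile_ds P uW) (profile_da P uW) (profile_db P uW).
rewrite (kE' uW) /c /S /T /pol0 /pol1.
move: (r u) (s u) (a u) (b u) ru su (a0 uW) (b0 uW) => x y z d x0 y0 z0 d0.
by field; rewrite ?x0 ?y0 ?z0 ?d0.
Qed.

Let DT u : W u -> D T u = c u * (2 * polk m l (S u) * (T u * (1 + T u))).
Proof.
move=> uW; have ru := r0 uW; have su := s0 uW; have au := a0 uW.
have -> : D T u = D (fun v => b v * (a v)^-1 * (b v * (a v)^-1)) u by [].
vfd_rec Wo uW => //.
rewrite (profile_da P uW) (profile_db P uW).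
rewrite (kE' uW) /c /S /T /polk.
move: (r u) (s u) (a u) (b u) ru su (a0 uW) (b0 uW) => x y z d x0 y0 z0 d0.
by field; rewrite ?x0 ?y0 ?z0 ?d0.
Qed.

Lemma profile_pol_dF u : W u -> pol_dF m l (S u) (T u) = 0.
Proof.
move=> uW; apply: (mulfI (c0 uW)); rewrite mulr0.
have : D (fun v => (3 - m) * m * (m + 3 + l * S v) * (T v * T v)
   + - (m * m * (m + 6) + m * l * (m + 3) * S v + m * l * (l + 3) * (S v * S v)
     + l * l * (l + 6) * (S v * S v * S v)) * T v
   + S v * S v * ((3 - l) * l * (m + (l + 3) * S v))) u = 0.
  rewrite (eq_vfd e Wo (G := fun=> 0) _ uW) ?vfd_cst// => v.
  by rewrite inE => vW; rewrite -(profile_pol_F vW).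
clearbody S T.
vfd_rec Wo uW; rewrite (DS uW) (DT uW) => <-.
rewrite /pol_dF /pol_f2 /pol_f1 /pol_df1 /pol0 /pol1 /polk.
by move: (S u) (T u) (c u) => x y z; ring.
Qed.

Let T_gt0 u : W u -> 0 < T u.
Proof.
by move=> uW; rewrite /T -expr2 exprn_even_gt0//= mulf_neq0 ?invr_eq0 ?a0 ?b0.
Qed.

Let S_neq0 u : W u -> S u != 0.
Proof.
by move=> uW; rewrite /S !mulf_neq0 ?invr_eq0 ?a0 ?b0 ?r0 ?s0.
Qed.

Let polk_neq0 u : W u -> polk m l (S u) != 0.
Proof.
move=> uW; have := mulf_neq0 (k0 uW) (mulf_neq0 (r0 uW) (invr_neq0 (a0 uW))).
apply: contra => /eqP pk0.
have -> : k u * (r u / a u) = - polk m l (S u) / 3.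
  rewrite (kE' uW) /S /polk.
  move: (r u) (s u) (a u) (b u) (r0 uW) (s0 uW) (a0 uW) => x y z d x0 y0 z0.
  by field; rewrite ?x0 ?y0 ?z0.
by rewrite pk0 oppr0 mul0r.
Qed.

Let DT_neq0 u : W u -> D T u != 0.
Proof.
move=> uW; rewrite (DT uW); have T0 : T u != 0 by rewrite gt_eqF ?T_gt0.
have T1 : 1 + T u != 0 by rewrite gt_eqF// ltr_wpDl ?T_gt0.
have n2 : (2 : R) != 0 by rewrite pnatr_eq0.
exact: mulf_neq0 (c0 uW) (mulf_neq0 (mulf_neq0 n2 (polk_neq0 uW)) (mulf_neq0 T0 T1)).
Qed.

(** For [m = 0] the resultant vanishes at 0, but [pol_F] loses its quadratic term and becomes
    [l * s^3] times an affine function of [t]. Hence [T] is constant, contrary to [DT_neq0]. *)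
Let m_eq0_empty u : W u -> m = 0 -> False.
Proof.
move=> uW mE; have l_neq0 : l != 0.
  by apply/eqP => lE; have := polk_neq0 uW; rewrite /polk mE lE mul0r addr0 eqxx.
have TE v : W v -> T v = (9 - l * l) / (l * (l + 6)).
  move=> vW; have := profile_pol_F vW.
  rewrite /pol_F /pol_f2 /pol_f1 /pol_g0 /pol1 /pol0 mE.
  have l6 : l + 6 != 0 by rewrite gt_eqF// ltr_wpDl.
  move: (S_neq0 vW); move: (S v) (T v) => x y x0 E.
  have H : l * x ^+ 3 != 0 by rewrite mulf_neq0 ?expf_neq0.
  have : l * x ^+ 3 * (9 - l * l - l * (l + 6) * y) = 0 by rewrite -[RHS]E; ring.
  move/eqP; rewrite mulf_eq0 (negbTE H) /= subr_eq0 => /eqP ->.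
  by rewrite mulrC mulKf// mulf_neq0.
have := DT_neq0 uW; rewrite (eq_vfd e Wo (G := fun=> (9 - l * l) / (l * (l + 6))) _ uW).
  by rewrite vfd_cst eqxx.
by move=> v; rewrite inE; exact: TE.
Qed.

Lemma nonconstant_profile_empty u : W u -> False.
Proof.
move=> uW.
have [mE|m_neq0] := eqVneq m 0; first exact: m_eq0_empty uW mE.
have m_gt0 : 0 < m by rewrite lt_neqAle eq_sym m_neq0.
pose Q : {poly R} := pol_res m%:P l%:P 'X.
have Q0 : Q != 0.
  apply/eqP => /(congr1 (horner^~ 0)); rewrite horner_pol_res pol_res0 horner0.
  apply/eqP; rewrite gt_eqF//.
  have m6 : 0 < m + 6 by lra.
  have lm : 0 < l + 3 * m + 18 by rewrite ltr_wpDl// addr_ge0// mulr_ge0.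
  have m3 : 0 < 2 * m + 3 by rewrite ltr_wpDl// mulr_ge0.
  by rewrite !mulr_gt0// exprn_gt0.
have QS v : W v -> Q.[S v] = 0.
  move=> vW; rewrite horner_pol_res; apply: (mulfI (S_neq0 vW)); rewrite mulr0.
  have E : pol_e1 m l (S v) * T v + S v * pol_e0 m l (S v) = 0.
    have : T v != 0 by rewrite gt_eqF ?T_gt0.
    move/mulfI; apply; rewrite mulr0.
    by have := profile_pol_dF vW; rewrite pol_dF_mod profile_pol_F// mulr0 add0r.
  by rewrite (pol_resE _ _ _ (T v)) profile_pol_F// E mulr0 mul0r subrr.
have DS0 v : W v -> D S v = 0 by exact: (vfd_algebraic Wo se sS Q0 QS).
have pE v : W v -> pol0 m l (S v) + T v * pol1 m l (S v) = 0.
  move=> vW; apply: (mulfI (S_neq0 vW)); apply: (mulfI (c0 vW)).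
  by rewrite -(DS vW) DS0// !mulr0.
(* With [S] constant this relation is affine in [T], whose derivative is nonzero, so both
   coefficients vanish. Their difference gives [S = 1], and then [m + l + 3 = 0]. *)
have : D (fun v => m + (l + 3) * S v + T v * (m + 3 + l * S v)) u = 0.
  rewrite (eq_vfd e Wo (G := fun=> 0) _ uW) ?vfd_cst// => v.
  by rewrite inE => vW; exact: pE.
have := DT_neq0 uW; have := pE u uW.
clearbody S T.
vfd_rec Wo uW; rewrite (DS0 u uW) /pol0 /pol1.
move: (S u) (T u) (D T u) => x y z E z0 E'.
have p1 : m + 3 + l * x = 0.
  by apply: (mulIf z0); rewrite mul0r -[RHS]E'; ring.
have lm : m + l + 3 = 0.
  move: E; rewrite p1 mulr0 addr0 => E.
  have x1 : x = 1 by lra.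
  by rewrite -[RHS]p1 x1; ring.
have : 0 < m + l + 3 by rewrite ltr_wpDl// addr_ge0.
by rewrite lm ltxx.
Qed.

End Nonconstant.

Lemma profile_minimal (R : realType) (n : nat) (W : set 'rV[R]_n) e
    (r s a b k lam : 'rV[R]_n -> R) (m l : R) :
  profile W e r s a b k -> smooth_on W lam -> 0 <= m -> 0 <= l ->
  (forall u, W u ->
    lam u = - (k u + m * (a u * (r u)^-1) + l * (b u * (s u)^-1))) ->
  (forall u, W u ->
    vfd e (vfd e (fun v => lam v * a v)) u +
    (m * (b u * (r u)^-1) - l * (a u * (s u)^-1)) * vfd e (fun v => lam v * a v) u =
    m * (lam u * a u * (r u) ^- 2)) ->
  (forall u, W u ->
    vfd e (vfd e (fun v => lam v * b v)) u +
    (m * (b u * (r u)^-1) - l * (a u * (s u)^-1)) * vfd e (fun v => lam v * b v) u =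
    l * (lam u * b u * (s u) ^- 2)) ->
  (forall u, W u -> lam u != 0) -> forall u, W u -> False.
Proof.
move=> P slam m0 l0 lamE La Lb lam0 u0 u0W.
have NE := profile_normal_eq P slam La Lb.
have TE := profile_tangent_eq P slam lamE La Lb.
have Wo := profile_open P; have se := profile_field P.
have sDl := smooth_vfd Wo se slam.
have D0 u : W u -> vfd e lam u = 0.
  move=> uW; apply/eqP; rewrite -[_ == _]negbK; apply/negP => Du.
  pose W1 := W `&` [set v | vfd e lam v != 0].
  have W1o : open W1 by exact: open_nonzero.
  have W1u : W1 u by [].
  have W1W : W1 `<=` W by move=> v [].
  have lamk v : W1 v -> lam v = 2 * k v.
    move=> [vW Dv]; apply/esym/eqP; rewrite -subr_eq0; apply/eqP.
    by apply: (mulIf Dv); rewrite mul0r TE.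
  have P1 := profile_subset W1o W1W P.
  have k0 v : W1 v -> k v != 0.
    move=> W1v; have := lam0 v (W1W v W1v); rewrite (lamk v W1v).
    by apply: contra => /eqP ->; rewrite mulr0.
  (* The variables [S] and [T] need [a] and [b] nonzero. If [a] vanished on [W1], then
     [k * b = D a = 0] would force [b = 0], against the unit length of the normal; [b] is treated
     likewise on [W2]. *)
  have [v0 W1v0 av0] : exists2 v, W1 v & a v != 0.
    apply: contrapT => H.
    have az w : W1 w -> a w = 0.
      by move=> W1w; apply/eqP/negPn/negP => aw; apply: H; exists w.
    have := profile_da P1 W1u.
    rewrite (eq_vfd e W1o (G := fun=> 0) _ W1u) ?vfd_cst; last first.
      by move=> w; rewrite inE; exact: az.
    move/esym/eqP; rewrite mulf_eq0 (negbTE (k0 _ W1u)) /= => /eqP bz.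
    have := profile_unit P1 W1u; rewrite az// bz expr0n addr0 => /eqP.
    by rewrite eq_sym oner_eq0.
  pose W2 := W1 `&` [set v | a v != 0].
  have W2o : open W2 by exact: open_nonzero W1o (profile_a P1).
  have W2W1 : W2 `<=` W1 by move=> w [].
  have P2 := profile_subset W2o W2W1 P1.
  pose W3 := W2 `&` [set v | b v != 0].
  have [v W3v] : exists v, W3 v.
    apply: contrapT => H.
    have bz w : W2 w -> b w = 0.
      by move=> W2w; apply/eqP/negPn/negP => bw; apply: H; exists w.
    have W2v0 : W2 v0 by [].
    have := profile_db P2 W2v0.
    rewrite (eq_vfd e W2o (G := fun=> 0) _ W2v0) ?vfd_cst; last first.
      by move=> w; rewrite inE; exact: bz.
    move/esym/eqP; rewrite oppr_eq0 mulf_eq0 (negbTE (k0 _ W1v0)) /=.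
    by rewrite (negbTE av0).
  have W3o : open W3 by exact: open_nonzero W2o (profile_b P2).
  have W3W1 : W3 `<=` W1 by move=> w [[]].
  have P3 := profile_subset W3o W3W1 P1.
  apply: (nonconstant_profile_empty P3 m0 l0) W3v.
  - by move=> w [[]].
  - by move=> w [].
  - by move=> w /W3W1/k0.
  - move=> w /W3W1 W1w; have := lamE w (W1W w W1w); rewrite (lamk w W1w).
    by move: (_ / r w) (_ / s w) => x y; lra.
  - move=> w /W3W1 W1w; have := NE w (W1W w W1w); rewrite (lamk w W1w).
    have e1 z : W1 z -> vfd e lam z = 2 * vfd e k z.
      move=> W1z; rewrite (eq_vfd e W1o (G := fun z => 2 * k z) _ W1z).
        have sk1 := profile_k P1.
        by vfd_rec W1o W1z; rewrite mulr0 addr0.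
      by move=> t; rewrite inE; exact: lamk.
    rewrite (e1 w W1w) (eq_vfd e W1o (G := fun z => 2 * vfd e k z) _ W1w); last first.
      by move=> t; rewrite inE; exact: e1.
    have sk1 := profile_k P1; have se1 := profile_field P1.
    vfd_rec W1o W1w; rewrite mulr0 addr0.
    move: (vfd e k w) (vfd e (vfd e k) w) (k w) (_ ^+ 2 + _ + _) (_ - _) => x y z t c.
    move=> H; have n2 : (2 : R) != 0 by rewrite pnatr_eq0.
    by apply: (mulfI n2); rewrite mulrDr mulrCA H mulrA.
(* With [D lam = 0] the normal equation says that [lam] times a weighted sum of squares is 0. So
   each weighted square vanishes, hence so does each term of the formula for [lam], also when a
   weight is 0. *)
have NE0 := NE u0 u0W.
move: NE0; rewrite (D0 _ u0W) mulr0 addr0.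
rewrite (eq_vfd e Wo (G := fun=> 0) _ u0W) ?vfd_cst; last first.
  by move=> v; rewrite inE; exact: D0.
move/esym/eqP; rewrite mulf_eq0 (negbTE (lam0 _ u0W)) /= => /eqP E.
have := lam0 _ u0W; rewrite (lamE _ u0W).
move: (k u0) (a u0 / r u0) (b u0 / s u0) E => x y z E.
have my : 0 <= m * y ^+ 2 by rewrite mulr_ge0// sqr_ge0.
have lz : 0 <= l * z ^+ 2 by rewrite mulr_ge0// sqr_ge0.
have xx := sqr_ge0 x.
have x0 : x ^+ 2 = 0 by lra.
have my0 : m * y ^+ 2 = 0 by lra.
have lz0 : l * z ^+ 2 = 0 by lra.
have -> : x = 0 by apply/eqP; rewrite -sqrf_eq0 x0.
have -> : m * y = 0 by apply/eqP; rewrite -sqrf_eq0 exprMn expr2 -mulrA my0 mulr0.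
have -> : l * z = 0 by apply/eqP; rewrite -sqrf_eq0 exprMn expr2 -mulrA lz0 mulr0.
by rewrite !addr0 oppr0 eqxx.
Qed.

(** * The orbits of one factor *)

(* The length of n times the mean curvature vector; see [mean_curvature_coord]. *)
HB.lock Definition meanc (R : realType) (n m : nat) (X : 'rV[R]_n -> 'rV[R]_m)
  (u : 'rV[R]_n) : R := Num.sqrt (\sum_k lap X (coordf X k) u ^+ 2).

HB.lock Definition orbit_radius (R : realType) (n m c : nat) (X : 'rV[R]_n -> 'rV[R]_m)
  (iota : 'I_c -> 'I_m) (u : 'rV[R]_n) : R :=
  Num.sqrt (\sum_i coordf X (iota i) u ^+ 2).

(* The component of the unit normal in the direction of the radius. *)
HB.lock Definition orbit_slope (R : realType) (n m c : nat) (X : 'rV[R]_n -> 'rV[R]_m)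
  (iota : 'I_c -> 'I_m) (u : 'rV[R]_n) : R :=
  (orbit_radius X iota u * meanc X u)^-1 *
  \sum_i coordf X (iota i) u * lap X (coordf X (iota i)) u.

Section Block.
Context {R : realType} {n m c : nat}.
Variables (W : set 'rV[R]_n) (X : 'rV[R]_n -> 'rV[R]_m) (iota : 'I_c -> 'I_m).
Hypothesis Wo : open W.
Hypothesis XI : smooth_immersion W X.
Hypothesis nm : n.+1 = m.
Hypothesis iota_inj : injective iota.
Implicit Types (F H : 'rV[R]_n -> R) (k : 'I_m) (u v : 'rV[R]_n).

Local Notation x := (coordf X).
Local Notation Lap := (lap X).
Local Notation Gam := (grad_dot X).
Local Notation lam := (meanc X).
Local Notation r := (orbit_radius X iota).
Local Notation a := (orbit_slope X iota).
Local Notation y i := (coordf X (iota i)).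

Hypothesis lam_neq0 : forall u, W u -> \sum_k Lap (x k) u ^+ 2 != 0.
Hypothesis r_neq0 : forall u, W u -> \sum_i y i u ^+ 2 != 0.
(** The block of a normal vector is parallel to the radius, because the orbits are tangent to the
    hypersurface. Stated by minors, this involves no division and is trivial for [c = 1]. *)
Hypothesis rot : forall u (v : 'rV[R]_m), W u -> v *m ('J X u)^T = 0 ->
  forall i j, y i u * v ord0 (iota j) = y j u * v ord0 (iota i).

Let smx k : smooth_on W (x k). Proof. exact: (smooth_coordf Wo XI). Qed.
Let smL F : smooth_on W F -> smooth_on W (Lap F).
Proof. exact: (smooth_lap Wo XI). Qed.
Let df F u : smooth_on W F -> W u -> differentiable F u.
Proof. exact: smooth_differentiable. Qed.

Let sum_gt0 (I : finType) (f : I -> R) : \sum_k f k ^+ 2 != 0 -> 0 < \sum_k f k ^+ 2.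
Proof. by move=> f0; rewrite lt_neqAle eq_sym f0 sum_sqr_ge0. Qed.

Lemma meanc_gt0 u : W u -> 0 < lam u.
Proof. by move=> uW; rewrite meanc.unlock sqrtr_gt0 sum_gt0// lam_neq0. Qed.

Lemma radius_gt0 u : W u -> 0 < r u.
Proof. by move=> uW; rewrite orbit_radius.unlock sqrtr_gt0 sum_gt0// r_neq0. Qed.

Lemma sqr_meanc u : lam u ^+ 2 = \sum_k Lap (x k) u ^+ 2.
Proof. by rewrite meanc.unlock sqr_sqrtr// sum_sqr_ge0. Qed.

Lemma sqr_radius u : r u ^+ 2 = \sum_i y i u ^+ 2.
Proof. by rewrite orbit_radius.unlock sqr_sqrtr// sum_sqr_ge0. Qed.

Lemma smooth_meanc : smooth_on W lam.
Proof.
rewrite meanc.unlock; apply: (smooth_sqrt Wo) => [|u uW].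
  by apply: (smooth_sum Wo) => k; apply: (smoothX Wo); apply: smL.
by rewrite sum_gt0// lam_neq0.
Qed.

Lemma smooth_radius : smooth_on W r.
Proof.
rewrite orbit_radius.unlock; apply: (smooth_sqrt Wo) => [|u uW].
  by apply: (smooth_sum Wo) => k; apply: (smoothX Wo).
by rewrite sum_gt0// r_neq0.
Qed.

Let sr := smooth_radius.
Let sl := smooth_meanc.

Lemma smooth_slope : smooth_on W a.
Proof.
rewrite orbit_slope.unlock; apply: (smoothM Wo).
  apply: (smoothV Wo); first exact: (smoothM Wo).
  by move=> u uW; rewrite mulf_neq0// gt_eqF ?radius_gt0 ?meanc_gt0.
apply: (smooth_sum Wo) => i; apply: (smoothM Wo) => //.
exact: smL.
Qed.

Lemma slopeE u : W u -> \sum_i y i u * Lap (y i) u = a u * (r u * lam u).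
Proof.
move=> uW; rewrite orbit_slope.unlock mulrC mulVKf// mulf_neq0// gt_eqF//.
- exact: radius_gt0.
- exact: meanc_gt0.
Qed.

Let eta u : 'rV[R]_m := \row_k Lap (x k) u.

Lemma meanc_normal u : W u -> (\row_k Lap (x k) u) *m ('J X u)^T = 0.
Proof.
move=> uW; apply/rowP => l; rewrite !mxE -[RHS](lap_coordf_normal Wo XI l uW).
by apply: eq_bigr => k _; rewrite !mxE -(jacobianE XI l k uW) mxE.
Qed.

Lemma lap_block i u : W u -> Lap (y i) u = a u * lam u / r u * y i u.
Proof.
move=> uW; have ru := radius_gt0 uW; have r0 : r u ^+ 2 != 0 by rewrite expf_neq0// gt_eqF.
apply: (mulfI r0); transitivity (y i u * (a u * (r u * lam u))); last first.
  by move: (r u) (lam u) (a u) (y i u) ru => b d e f b0; field; rewrite gt_eqF.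
rewrite -slopeE// sqr_radius// mulr_suml mulr_sumr; apply: eq_bigr => j _.
have := rot uW (meanc_normal uW) i j; rewrite !mxE => E.
by rewrite expr2 -mulrA -E mulrCA.
Qed.

(** The gradients of the coordinates are the tangential projections of the basis vectors, and
    [Lap X / lam] is a unit normal. *)
Lemma grad_dot_coordfE k k' u : W u ->
  Gam (x k) (x k') u = (k == k')%:R - Lap (x k) u * Lap (x k') u / lam u ^+ 2.
Proof.
move=> uW; rewrite (grad_dot_coordf XI)//.
have v0 : eta u != 0.
  apply: contraNneq (lam_neq0 uW) => e0; apply/eqP; rewrite big1// => j _.
  by have /rowP/(_ j) := e0; rewrite !mxE => ->; rewrite expr0n.
rewrite (tangent_proj_normal XI nm uW v0 (meanc_normal uW)).
rewrite mulmx_trmx_row0 !mxE big_ord1 !mxE sqr_meanc//.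
under eq_bigr do rewrite mxE.
by rewrite mulrC.
Qed.

Lemma partial_radius i u : W u ->
  r u * pd i r u = \sum_j y j u * pd i (y j) u.
Proof.
move=> uW; have E :
    pd i (fun v => r v * r v) u = pd i (fun v => \sum_j y j v * y j v) u.
  apply: (eq_partial Wo) => [v|]; last by rewrite inE.
  by move=> _; rewrite -expr2 sqr_radius.
have n2 : (2 : R) != 0 by rewrite pnatr_eq0.
apply: (mulfI n2); move: E; rewrite partialM; [|exact: df..].
rewrite partial_sum => [|j]; last by apply: (df _ uW); apply: (smoothM Wo).
move=> E; rewrite mulrDl mul1r E mulr_sumr; apply: eq_bigr => j _.
rewrite partialM; [|exact: df..].
ring_at u.
Qed.

Lemma grad_dot_radius F u : W u ->
  r u * Gam r F u = \sum_j y j u * Gam (y j) F u.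
Proof.
move=> uW; rewrite grad_dot.unlock mulr_sumr.
under [RHS]eq_bigr do rewrite mulr_sumr.
rewrite [RHS]exchange_big /=; apply: eq_bigr => i _.
rewrite mulr_sumr; under [RHS]eq_bigr do rewrite mulr_sumr.
rewrite [RHS]exchange_big /=; apply: eq_bigr => j _.
transitivity (invg X i j u * pd j F u * (r u * pd i r u)); first by ring_at u.
by rewrite partial_radius// mulr_sumr; apply: eq_bigr => k _; ring_at u.
Qed.

Lemma grad_dot_radius_in i u : W u -> r u * Gam r (y i) u = (1 - a u ^+ 2) * y i u.
Proof.
move=> uW; have l0 := meanc_gt0 uW; have r0 := radius_gt0 uW; rewrite grad_dot_radius//.
transitivity (y i u - (Lap (y i) u / lam u ^+ 2) * \sum_j y j u * Lap (y j) u).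
  rewrite mulr_sumr [X in X - _](_ : _ = \sum_j y j u * (j == i)%:R); last first.
    rewrite (bigD1 i)//= eqxx mulr1 big1 ?addr0// => j /negbTE ->.
    by rewrite mulr0n mulr0.
  rewrite -sumrB; apply: eq_bigr => j _; rewrite grad_dot_coordfE// inj_eq//.
  by move: ((j == i)%:R : R) (lam u ^+ 2) => t z; ring_at u.
rewrite slopeE// lap_block//; move: (r u) (lam u) (a u) (y i u) r0 l0 => b d e f b0 d0.
by field; rewrite !gt_eqF.
Qed.

Lemma grad_dot_radius_out k u : (forall i, iota i != k) -> W u ->
  Gam r (x k) u = - a u * Lap (x k) u / lam u.
Proof.
move=> ik uW; have l0 := meanc_gt0 uW; have r0 := radius_gt0 uW.
have rn0 : r u != 0 by rewrite gt_eqF.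
apply: (mulfI rn0); rewrite grad_dot_radius//.
transitivity (- (Lap (x k) u / lam u ^+ 2) * \sum_j y j u * Lap (y j) u).
  rewrite mulr_sumr; apply: eq_bigr => j _; rewrite grad_dot_coordfE// (negbTE (ik j)).
  by rewrite mulr0n; move: (lam u ^+ 2) => z; ring_at u.
rewrite slopeE//; move: (r u) (lam u) (a u) (lap _ _ _) r0 l0 => b d e f b0 d0.
by field; rewrite !gt_eqF.
Qed.

Lemma sum_sqr_lap_block u : W u -> \sum_i Lap (y i) u ^+ 2 = (a u * lam u) ^+ 2.
Proof.
move=> uW; have r0 := radius_gt0 uW.
under eq_bigr do rewrite lap_block// exprMn.
rewrite -mulr_sumr -sqr_radius// -exprMn mulfVK// gt_eqF//.
Qed.

Lemma sum_grad_dot_block u : W u -> \sum_i Gam (y i) (y i) u = c%:R - a u ^+ 2.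
Proof.
move=> uW; have l0 := meanc_gt0 uW.
under eq_bigr do rewrite grad_dot_coordfE// eqxx -expr2.
rewrite sumrB sumr_const card_ord -mulr_suml sum_sqr_lap_block// exprMn mulfK//.
by rewrite expf_neq0// gt_eqF.
Qed.

(** Both sides are half the Laplacian of [r^2], the sum of the [y_j^2]; the part [c - a^2] is the
    trace of the tangential projection on the block. *)
Lemma lap_radius u : W u ->
  r u * Lap r u + Gam r r u = a u * r u * lam u + c%:R - a u ^+ 2.
Proof.
move=> uW; have E : Lap (fun v => r v * r v) u = Lap (fun v => \sum_j y j v * y j v) u.
  apply: (eq_lap Wo XI) => //; first exact: (smoothM Wo).
  by move=> v; rewrite inE => vW; rewrite -expr2 sqr_radius//.
have n2 : (2 : R) != 0 by rewrite pnatr_eq0.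
apply: (mulfI n2); move: E; rewrite (lapM Wo XI sr sr uW) (lap_sum Wo XI) => [|j|]//;
  last exact: (smoothM Wo).
move=> E; transitivity (r u * Lap r u + r u * Lap r u + 2 * Gam r r u).
  by ring_at u.
rewrite E; have -> : a u * r u * lam u + c%:R - a u ^+ 2 =
    \sum_j y j u * Lap (y j) u + \sum_j Gam (y j) (y j) u.
  by rewrite slopeE// sum_grad_dot_block// mulrA addrA.
rewrite -big_split /= mulr_sumr; apply: eq_bigr => j _ /=; rewrite (lapM Wo XI)//; ring_at u.
Qed.

Let A v := a v * lam v / r v.

Let sA : smooth_on W A.
Proof.
apply: (smoothM Wo); first by apply: (smoothM Wo) => //; exact: smooth_slope.
by apply: (smoothV Wo) => // v vW; rewrite gt_eqF// radius_gt0.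
Qed.

(** With [A = a lam / r], biharmonicity reads [Lap (A y_i) = 0]; dividing by a nonzero [y_i] gives
    [Lap A = - A^2 - 2 d / r]. In the product rule for [r A] these two terms cancel against those of
    [A Lap r] and of the gradients. The numbers [b] and [d] stay abstract to serve both factors. *)
Lemma lap_slope_meanc (b d : R) u : W u ->
  (forall k, Lap (Lap (x k)) u = 0) ->
  (forall i, Gam (fun v => a v * lam v / r v) (y i) u = d * (y i u / r u)) ->
  Gam r (fun v => a v * lam v / r v) u = d ->
  Gam r r u = b ^+ 2 -> a u ^+ 2 + b ^+ 2 = 1 ->
  Lap (fun v => a v * lam v) u = (c%:R - 1) * (a u * lam u / r u ^+ 2).
Proof.
move=> uW biharm GA GrA Grr ab; have r0 := radius_gt0 uW.
have rn0 : r u != 0 by rewrite gt_eqF.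
have [i yi0] : exists i, y i u != 0.
  apply: contrapT => H; have := r_neq0 uW; rewrite big1 ?eqxx// => i _.
  have [->|yi0] := eqVneq (y i u) 0; first by rewrite expr0n.
  by case: H; exists i.
have sy := smx (iota i).
have LA : Lap A u + A u * A u + 2 * (d / r u) = 0.
  apply: (mulIf yi0); rewrite mul0r -(biharm (iota i)).
  rewrite (eq_lap Wo XI (F := Lap (y i)) (H := fun v => A v * y i v) _ _ uW).
  - rewrite (lapM Wo XI sA sy uW) GA lap_block//.
    by rewrite -/(A u) -[d * (_ / _)]mulrCA; move: (A u) (Lap A u) => s t; ring_at u.
  - exact: smL.
  - by move=> v; rewrite inE; exact: lap_block.
have srA : smooth_on W (fun v => r v * A v) by exact: (smoothM Wo).
have E v : W v -> r v * A v = a v * lam v.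
  by move=> vW; rewrite /A mulrC mulfVK// gt_eqF// radius_gt0.
rewrite -(eq_lap Wo XI srA _ uW); last by move=> v; rewrite inE; exact: E.
rewrite (lapM Wo XI sr sA uW) GrA.
have Lr : Lap r u = a u * lam u + (c%:R - 1) / r u.
  apply: (mulfI rn0); have := lap_radius uW; rewrite Grr => /(canRL (addrK _)) ->.
  by rewrite -ab; move: (r u) (a u) (lam u) rn0 => s t z s0; field.
have -> : Lap A u = - (A u * A u + 2 * (d / r u)).
  by apply/eqP; rewrite -addr_eq0 addrA LA.
rewrite Lr /A; move: (r u) (a u) (lam u) rn0 => s t z s0.
by field.
Qed.

End Block.

(** * The frame normal to the orbits *)

Section Frame.
Context {R : realType} {n p q : nat}.
Variables (W : set 'rV[R]_n) (X : 'rV[R]_n -> 'rV[R]_(p + q)).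
Hypothesis Wo : open W.
Hypothesis XI : smooth_immersion W X.
Hypothesis nm : n.+1 = (p + q)%N.
Hypotheses (p_gt0 : (0 < p)%N) (q_gt0 : (0 < q)%N).
Implicit Types (F H : 'rV[R]_n -> R) (u v : 'rV[R]_n).

Local Notation x := (coordf X).
Local Notation Lap := (lap X).
Local Notation Gam := (grad_dot X).
Local Notation lam := (meanc X).
Local Notation iotaL := (@lshift p q).
Local Notation iotaR := (@rshift p q).
Local Notation r := (orbit_radius X iotaL).
Local Notation s := (orbit_radius X iotaR).
Local Notation a := (orbit_slope X iotaL).
Local Notation b := (orbit_slope X iotaR).

Hypothesis lam_neq0 : forall u, W u -> \sum_k Lap (x k) u ^+ 2 != 0.
Hypothesis r_neq0 : forall u, W u -> \sum_i x (iotaL i) u ^+ 2 != 0.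
Hypothesis s_neq0 : forall u, W u -> \sum_i x (iotaR i) u ^+ 2 != 0.
Hypothesis rotL : forall u (v : 'rV[R]_(p + q)), W u -> v *m ('J X u)^T = 0 ->
  forall i j, x (iotaL i) u * v ord0 (iotaL j) = x (iotaL j) u * v ord0 (iotaL i).
Hypothesis rotR : forall u (v : 'rV[R]_(p + q)), W u -> v *m ('J X u)^T = 0 ->
  forall i j, x (iotaR i) u * v ord0 (iotaR j) = x (iotaR j) u * v ord0 (iotaR i).
Hypothesis biharm : forall u, W u -> forall k, Lap (Lap (x k)) u = 0.

Let injL : injective iotaL. Proof. exact: lshift_inj. Qed.
Let injR : injective iotaR. Proof. exact: rshift_inj. Qed.
Let smx k : smooth_on W (x k). Proof. exact: (smooth_coordf Wo XI). Qed.
Let sg i j : smooth_on W (invg X i j). Proof. exact: (smooth_invg Wo XI). Qed.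
Let sr : smooth_on W r. Proof. exact: (smooth_radius Wo XI r_neq0). Qed.
Let ss : smooth_on W s. Proof. exact: (smooth_radius Wo XI s_neq0). Qed.
Let sl : smooth_on W lam. Proof. exact: (smooth_meanc Wo XI lam_neq0). Qed.
Let sa : smooth_on W a.
Proof. exact: (smooth_slope Wo XI lam_neq0 r_neq0). Qed.
Let sb : smooth_on W b.
Proof. exact: (smooth_slope Wo XI lam_neq0 s_neq0). Qed.
Let r0 u : W u -> r u != 0.
Proof. by move=> uW; rewrite gt_eqF// (radius_gt0 r_neq0). Qed.
Let s0 u : W u -> s u != 0.
Proof. by move=> uW; rewrite gt_eqF// (radius_gt0 s_neq0). Qed.
Let l0 u : W u -> lam u != 0.
Proof. by move=> uW; rewrite gt_eqF// (meanc_gt0 lam_neq0). Qed.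
Let df F u : smooth_on W F -> W u -> differentiable F u.
Proof. exact: smooth_differentiable. Qed.
Let sp i F : smooth_on W F -> smooth_on W (pd i F).
Proof. exact: smooth_partial. Qed.

(* The coordinates of the 1-form dual to the unit field normal to the orbits. *)
Let tau i v := b v * pd i r v - a v * pd i s v.
Let e i v := \sum_j invg X i j v * tau j v.
Local Notation D := (vfd e).

Let stau i : smooth_on W (tau i).
Proof. by apply: (smoothB Wo); apply: (smoothM Wo) => //; apply: sp. Qed.

Let se i : smooth_on W (e i).
Proof. by apply: (smooth_sum Wo) => j; apply: (smoothM Wo). Qed.

Let ab1 u : W u -> a u ^+ 2 + b u ^+ 2 = 1.
Proof.
move=> uW; have l2 : lam u ^+ 2 != 0 by rewrite expf_neq0// l0.
apply: (mulIf l2); rewrite mul1r [RHS]sqr_meanc// big_split_ord /=.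
rewrite (sum_sqr_lap_block Wo XI lam_neq0 r_neq0 rotL uW).
rewrite (sum_sqr_lap_block Wo XI lam_neq0 s_neq0 rotR uW).
by rewrite !exprMn mulrDl.
Qed.

Let normal_rs i u : W u -> a u * pd i r u + b u * pd i s u = 0.
Proof.
move=> uW; apply: (mulIf (l0 uW)); rewrite mul0r -(lap_coordf_normal Wo XI i uW).
rewrite big_split_ord /= mulrDl; apply: f_equal2.
- transitivity (a u * lam u / r u * (r u * pd i r u)).
    by move: (r u) (r0 uW) (a u) (lam u) (pd i r u) => ? ? ? ? ?; field.
  rewrite (partial_radius Wo XI r_neq0 i uW) mulr_sumr; apply: eq_bigr => j _.
  by rewrite (lap_block Wo XI lam_neq0 r_neq0 rotL j uW) mulrA.
- transitivity (b u * lam u / s u * (s u * pd i s u)).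
    by move: (s u) (s0 uW) (b u) (lam u) (pd i s u) => ? ? ? ? ?; field.
  rewrite (partial_radius Wo XI s_neq0 i uW) mulr_sumr; apply: eq_bigr => j _.
  by rewrite (lap_block Wo XI lam_neq0 s_neq0 rotR j uW) mulrA.
Qed.

(** By [normal_rs] the pair (dr, ds) is orthogonal to the unit pair (a, b), hence a multiple of (b,
    -a). *)
Let partial_r i u : W u -> pd i r u = b u * tau i u.
Proof.
move=> uW; have N := normal_rs i uW; have U := ab1 uW.
transitivity ((a u ^+ 2 + b u ^+ 2) * pd i r u - a u * (a u * pd i r u + b u * pd i s u)).
  by rewrite N U mul1r mulr0 subr0.
by rewrite /tau; ring_at u.
Qed.

Let partial_s i u : W u -> pd i s u = - a u * tau i u.
Proof.
move=> uW; have N := normal_rs i uW; have U := ab1 uW.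
transitivity ((a u ^+ 2 + b u ^+ 2) * pd i s u - b u * (a u * pd i r u + b u * pd i s u)).
  by rewrite N U mul1r mulr0 subr0.
by rewrite /tau; ring_at u.
Qed.

Let grad_dot_inv F H (f : R) u : (forall i, pd i F u = f * tau i u) ->
  Gam F H u = f * D H u.
Proof.
move=> Fi; rewrite grad_dot.unlock vfd.unlock exchange_big mulr_sumr.
apply: eq_bigr => j _ /=; rewrite /e mulr_suml mulr_sumr; apply: eq_bigr => i _.
rewrite Fi invg_sym; ring_at u.
Qed.

(** The gradients of [r] and [s] give [b D] and [- a D]; their combination with coefficients [b] and
    [- a] recovers [D] even where [a] or [b] vanishes. *)
Let D_coordL i u : W u -> D (x (iotaL i)) u = b u * (x (iotaL i) u / r u).
Proof.
move=> uW; have U := ab1 uW.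
have Er : b u * D (x (iotaL i)) u = b u ^+ 2 * (x (iotaL i) u / r u).
  rewrite -(grad_dot_inv _ (fun i => partial_r i uW)); apply: (mulfI (r0 uW)).
  rewrite (grad_dot_radius_in Wo XI nm injL lam_neq0 r_neq0 rotL)//.
  rewrite -U; move: (r u) (r0 uW) (a u) (b u) (x _ u) => ? ? ? ? ?; by field.
have Es : - a u * D (x (iotaL i)) u = - a u * (b u * (x (iotaL i) u / r u)).
  rewrite -(grad_dot_inv _ (fun i => partial_s i uW)).
  rewrite (grad_dot_radius_out Wo XI nm lam_neq0 s_neq0) => [|j|]//; last first.
    by rewrite eq_rlshift.
  rewrite (lap_block Wo XI lam_neq0 r_neq0 rotL)//.
  move: (r u) (r0 uW) (lam u) (l0 uW) (a u) (b u) (x _ u) => c c0 d d0 f g h.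
  by field; rewrite ?c0 ?d0.
rewrite -[LHS]mul1r -U.
transitivity (b u * (b u * D (x (iotaL i)) u) - a u * (- a u * D (x (iotaL i)) u)).
  by ring_at u.
rewrite Er Es; transitivity ((a u ^+ 2 + b u ^+ 2) * (b u * (x (iotaL i) u / r u))).
  by move: (_ / _) => z; ring_at u.
by rewrite U mul1r.
Qed.

Let D_coordR i u : W u -> D (x (iotaR i)) u = - a u * (x (iotaR i) u / s u).
Proof.
move=> uW; have U := ab1 uW.
have Es : - a u * D (x (iotaR i)) u = a u ^+ 2 * (x (iotaR i) u / s u).
  rewrite -(grad_dot_inv _ (fun i => partial_s i uW)); apply: (mulfI (s0 uW)).
  rewrite (grad_dot_radius_in Wo XI nm injR lam_neq0 s_neq0 rotR)//.
  rewrite -U; move: (s u) (s0 uW) (a u) (b u) (x _ u) => ? ? ? ? ?; by field.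
have Er : b u * D (x (iotaR i)) u = - a u * (b u * (x (iotaR i) u / s u)).
  rewrite -(grad_dot_inv _ (fun i => partial_r i uW)).
  rewrite (grad_dot_radius_out Wo XI nm lam_neq0 r_neq0) => [|j|]//; last first.
    by rewrite eq_lrshift.
  rewrite (lap_block Wo XI lam_neq0 s_neq0 rotR)//.
  move: (s u) (s0 uW) (lam u) (l0 uW) (a u) (b u) (x _ u) => c c0 d d0 f g h.
  by field; rewrite ?c0 ?d0.
rewrite -[LHS]mul1r -U.
transitivity (b u * (b u * D (x (iotaR i)) u) - a u * (- a u * D (x (iotaR i)) u)).
  by ring_at u.
rewrite Er Es; transitivity ((a u ^+ 2 + b u ^+ 2) * (- a u * (x (iotaR i) u / s u))).
  by move: (_ / _) => z; ring_at u.
by rewrite U mul1r.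
Qed.

Let vfd_radius (c : nat) (iota : 'I_c -> 'I_(p + q)) (f : R) u :
  (forall v, W v -> \sum_i x (iota i) v ^+ 2 != 0) -> W u ->
  (forall i, D (x (iota i)) u = f * (x (iota i) u / orbit_radius X iota u)) ->
  D (orbit_radius X iota) u = f.
Proof.
move=> iota0 uW Dx; have ru : orbit_radius X iota u != 0 by rewrite gt_eqF// (radius_gt0 iota0).
apply: (mulfI ru); transitivity (\sum_j x (iota j) u * D (x (iota j)) u).
  rewrite vfd.unlock mulr_sumr; under [RHS]eq_bigr do rewrite mulr_sumr.
  rewrite [RHS]exchange_big /=; apply: eq_bigr => i _.
  rewrite mulrCA (partial_radius Wo XI iota0 i uW) mulr_sumr.
  by apply: eq_bigr => j _; rewrite mulrCA.
transitivity (f / orbit_radius X iota u * \sum_j x (iota j) u ^+ 2).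
  rewrite mulr_sumr; apply: eq_bigr => j _; rewrite Dx.
  by move: (orbit_radius _ _ u) ru => t t0; move: (x _ u) => z; field.
rewrite -sqr_radius//; move: (orbit_radius _ _ u) ru => t t0; by field.
Qed.

Let Dr u : W u -> D r u = b u.
Proof. by move=> uW; apply: (vfd_radius r_neq0) => // i; exact: D_coordL. Qed.

Let Ds u : W u -> D s u = - a u.
Proof. by move=> uW; apply: (vfd_radius s_neq0) => // i; exact: D_coordR. Qed.

Let norm_tau u : W u -> \sum_i e i u * tau i u = 1.
Proof.
move=> uW; set t := \sum_i _.
have E1 : b u = b u * t.
  rewrite -{1}(Dr uW) vfd.unlock mulr_sumr; apply: eq_bigr => i _.
  by rewrite partial_r// mulrCA.
have E2 : - a u = - a u * t.
  rewrite -{1}(Ds uW) vfd.unlock mulr_sumr; apply: eq_bigr => i _.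
  by rewrite partial_s// mulrCA.
rewrite -[t]mul1r -(ab1 uW); transitivity (b u * (b u * t) - a u * (- a u * t)).
  by clearbody t; ring_at u.
by rewrite -E1 -E2; ring_at u.
Qed.

(** From [dr = b tau] and [ds = - a tau], both closed: [b] times the first identity minus [a] times
    the second leaves [d tau], since [a da + b db = 0]. *)
Let closed_tau i j u : W u -> pd i (tau j) u = pd j (tau i) u.
Proof.
move=> uW; have uW' : u \in W by rewrite inE.
have Er k l : pd k (pd l r) u = b u * pd k (tau l) u + tau l u * pd k b u.
  rewrite (eq_partial Wo k (G := fun v => b v * tau l v) _ uW').
    exact: (partialM _ (df sb uW) (df (stau l) uW)).
  by move=> v; rewrite inE; exact: partial_r.
have Es k l : pd k (pd l s) u = - a u * pd k (tau l) u + tau l u * - pd k a u.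
  rewrite (eq_partial Wo k (G := fun v => - a v * tau l v) _ uW').
    rewrite (partialM _ (df (smoothN Wo sa) uW) (df (stau l) uW)).
    by rewrite (partialN _ (df sa uW)).
  by move=> v; rewrite inE; exact: partial_s.
have Cr := partialC Wo i j sr uW; rewrite !Er in Cr.
have Cs := partialC Wo i j ss uW; rewrite !Es in Cs.
have Dab l : a u * pd l a u + b u * pd l b u = 0.
  have n2 : (2 : R) != 0 by rewrite pnatr_eq0.
  apply: (mulfI n2); rewrite mulr0 -[RHS](partial_cst 1 l u).
  rewrite -(eq_partial Wo l (F := fun v => a v * a v + b v * b v) (G := fun=> 1) _ uW').
    rewrite partialD; [|exact: (df (smoothM Wo sa sa) uW)|exact: (df (smoothM Wo sb sb) uW)].
    rewrite !partialM; try exact: (df _ uW).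
    by ring_at u.
  by move=> v; rewrite inE => vW; rewrite -!expr2 ab1.
apply/eqP; rewrite -subr_eq0 -[X in X == _]mul1r -(ab1 uW); apply/eqP.
transitivity (b u * ((b u * pd i (tau j) u + tau j u * pd i b u)
      - (b u * pd j (tau i) u + tau i u * pd j b u))
   - a u * ((- a u * pd i (tau j) u + tau j u * - pd i a u)
      - (- a u * pd j (tau i) u + tau i u * - pd j a u))
   - tau j u * (a u * pd i a u + b u * pd i b u)
   + tau i u * (a u * pd j a u + b u * pd j b u)).
  by move: (tau i u) (tau j u) => *; ring_at u.
by rewrite Cr Cs !Dab !subrr !mulr0 !subr0 addr0.
Qed.

(* Functions of the profile parameter: their differential is a multiple of [tau]. *)
Let inv F := smooth_on W F /\
  forall u, W u -> forall i, pd i F u = D F u * tau i u.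

(** If [dF = H tau], then the wedge product of [dH] and [tau] vanishes because [tau] is closed;
    contraction with [e], on which [tau] is 1, gives [dH = (D H) tau]. *)
Let inv_coef F H : smooth_on W F -> smooth_on W H ->
  (forall u, W u -> forall i, pd i F u = H u * tau i u) -> inv H.
Proof.
move=> sF sH FH; split=> // u uW i; have uW' : u \in W by rewrite inE.
have E k l : pd k (pd l F) u = H u * pd k (tau l) u + tau l u * pd k H u.
  rewrite (eq_partial Wo k (G := fun v => H v * tau l v) _ uW').
    exact: (partialM _ (df sH uW) (df (stau l) uW)).
  by move=> v; rewrite inE => vW; exact: FH.
have C l : tau l u * pd i H u = tau i u * pd l H u.
  have := partialC Wo i l sF uW; rewrite !E closed_tau//; exact: addrI.
rewrite -[LHS]mul1r -(norm_tau uW) vfd.unlock !mulr_suml; apply: eq_bigr => l _.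
by rewrite -mulrA C mulrCA mulrC.
Qed.

Let inv_D F : inv F -> inv (D F).
Proof.
move=> [sF iF]; apply: (inv_coef sF _ iF); exact: (smooth_vfd Wo se).
Qed.

Let inv_r : inv r.
Proof. by split=> // u uW i; rewrite Dr// partial_r. Qed.

Let inv_s : inv s.
Proof. by split=> // u uW i; rewrite Ds// partial_s. Qed.

Let inv_b : inv b.
Proof. by apply: (inv_coef sr sb) => u uW i; exact: partial_r. Qed.

Let inv_N F : inv F -> inv (fun v => - F v).
Proof.
move=> [sF iF]; split=> [|u uW i]; first exact: (smoothN Wo).
by rewrite (partialN _ (df sF uW)) (vfdN e sF uW) iF// mulNr.
Qed.

Let inv_a : inv a.
Proof.
have -> : a = fun v => - - a v by apply/funext => v; rewrite opprK.
apply: inv_N; apply: (inv_coef ss (smoothN Wo sa)) => u uW i.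
exact: partial_s.
Qed.

Let inv_cst c : inv (fun=> c).
Proof.
split=> [|u uW i]; first exact: (smooth_cst Wo).
by rewrite (partial_cst c i u) (vfd_cst e c u) mul0r.
Qed.

Let inv_M F H : inv F -> inv H -> inv (fun v => F v * H v).
Proof.
move=> [sF iF] [sH iH]; split=> [|u uW i]; first exact: (smoothM Wo).
rewrite (partialM _ (df sF uW) (df sH uW)) (vfdM e sF sH uW) iF// iH//.
by move: (tau i u) => t; ring_at u.
Qed.

Let inv_Add F H : inv F -> inv H -> inv (fun v => F v + H v).
Proof.
move=> [sF iF] [sH iH]; split=> [|u uW i]; first exact: (smoothD Wo).
by rewrite (partialD _ (df sF uW) (df sH uW)) (vfdD e sF sH uW) iF// iH// mulrDl.
Qed.

Let inv_V F : inv F -> (forall u, W u -> F u != 0) -> inv (fun v => (F v)^-1).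
Proof.
move=> [sF iF] F0; split=> [|u uW i]; first exact: (smoothV Wo).
by rewrite (partialV _ (df sF uW) (F0 u uW)) (vfdV e sF uW (F0 u uW)) iF// mulrA.
Qed.

Let eq_inv F H : {in W, F =1 H} -> inv F -> inv H.
Proof.
move=> FH [sF iF]; split=> [|u uW i]; first exact: (eq_smooth Wo FH).
have uW' : u \in W by rewrite inE.
by rewrite -(eq_partial Wo i FH uW') -(eq_vfd e Wo FH uW) iF.
Qed.

(** The divergence of [e]. A function satisfying [inv] has gradient [D F] times [e], whose
    divergence is its Laplacian. *)
Let delta u := (vol X u)^-1 * \sum_i pd i (fun v => vol X v * e i v) u.

Let lap_inv F u : inv F -> W u -> Lap F u = D (D F) u + delta u * D F u.
Proof.
move=> [sF iF] uW; have uW' : u \in W by rewrite inE.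
have sw : smooth_on W (vol X) by exact: (smooth_vol Wo XI).
have sDF : smooth_on W (D F) by exact: (smooth_vfd Wo se sF).
have w0 : vol X u != 0 by rewrite gt_eqF// (vol_gt0 XI).
have swe i : smooth_on W (fun v => vol X v * e i v) by exact: (smoothM Wo sw (se i)).
rewrite lap.unlock /delta.
have E i : pd i (fun v => vol X v * \sum_j invg X i j v * pd j F v) u =
    vol X u * (e i u * pd i (D F) u) + pd i (fun v => vol X v * e i v) u * D F u.
  rewrite (eq_partial Wo i (G := fun v => vol X v * e i v * D F v) _ uW').
    rewrite (partialM _ (df (swe i) uW) (df sDF uW)).
    by rewrite -mulrA [X in _ + X]mulrC.
  move=> v; rewrite inE => vW; rewrite -mulrA; congr (_ * _).
  rewrite /e mulr_suml; apply: eq_bigr => j _; rewrite iF//.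
  by rewrite -mulrA [X in _ * X]mulrC.
rewrite (eq_bigr _ (fun i _ => E i)) big_split /= -mulr_sumr -mulr_suml mulrDr.
by rewrite mulKf// mulrA [in RHS](vfdE _ (D F)).
Qed.

(** The curvature of the profile curve: the derivative of the unit pair (a, b) is orthogonal to it,
    hence [kap] times (b, -a). *)
Let kap v := b v * D a v - a v * D b v.

Let DabD u : W u -> a u * D a u + b u * D b u = 0.
Proof.
move=> uW; have n2 : (2 : R) != 0 by rewrite pnatr_eq0.
apply: (mulfI n2); rewrite mulr0 -[RHS](vfd_cst e 1 u).
rewrite -(eq_vfd e Wo (F := fun v => a v * a v + b v * b v) (G := fun=> 1) _ uW).
  rewrite (vfdD e (smoothM Wo sa sa) (smoothM Wo sb sb) uW).
  by rewrite (vfdM e sa sa uW) (vfdM e sb sb uW); ring_at u.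
by move=> v; rewrite inE => vW; rewrite -!expr2 ab1.
Qed.

Let Da u : W u -> D a u = kap u * b u.
Proof.
move=> uW; have := DabD uW; rewrite /kap => E; rewrite -[LHS]mul1r -(ab1 uW).
transitivity ((b u * D a u - a u * D b u) * b u + a u * (a u * D a u + b u * D b u)).
  by ring_at u.
by rewrite E mulr0 addr0.
Qed.

Let Db u : W u -> D b u = - (kap u * a u).
Proof.
move=> uW; have := DabD uW; rewrite /kap => E; rewrite -[LHS]mul1r -(ab1 uW).
transitivity (- ((b u * D a u - a u * D b u) * a u) + b u * (a u * D a u + b u * D b u)).
  by ring_at u.
by rewrite E mulr0 addr0.
Qed.

Let inv_kap : inv kap.
Proof.
by apply: inv_Add; [|apply: inv_N]; apply: inv_M => //; apply: inv_D.
Qed.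

Let lap_r u : W u ->
  - (kap u * a u) + delta u * b u = a u * lam u + (p%:R - 1) / r u.
Proof.
move=> uW; have := lap_radius Wo XI nm lam_neq0 r_neq0 rotL uW.
rewrite (grad_dot_inv _ (fun i => partial_r i uW)) Dr// (lap_inv inv_r uW) Dr//.
rewrite (eq_vfd e Wo (G := b) _ uW) ?Db//; last by move=> v; rewrite inE; exact: Dr.
have := ab1 uW; move: (r u) (r0 uW) (kap u) (delta u) (lam u) (a u) (b u).
move=> rr rr0 kk dd ll aa bb U E; apply: (mulfI rr0); apply: (addIr (bb * bb)).
by rewrite E -U; field.
Qed.

Let lap_s u : W u ->
  - (kap u * b u) - delta u * a u = b u * lam u + (q%:R - 1) / s u.
Proof.
move=> uW; have := lap_radius Wo XI nm lam_neq0 s_neq0 rotR uW.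
rewrite (grad_dot_inv _ (fun i => partial_s i uW)) Ds// (lap_inv inv_s uW) Ds//.
rewrite (eq_vfd e Wo (G := fun v => - a v) _ uW); last by move=> v; rewrite inE; exact: Ds.
rewrite (vfdN e sa uW) Da//.
have := ab1 uW; move: (s u) (s0 uW) (kap u) (delta u) (lam u) (a u) (b u).
move=> rr rr0 kk dd ll aa bb U E; apply: (mulfI rr0); apply: (addIr (aa * aa)).
transitivity (rr * (- (kk * bb) + dd * - aa) + - aa * - aa); first by ring.
by rewrite E -U; field.
Qed.

(** [lap_r] and [lap_s] are the two components of one vector identity; its product with (b, -a)
    gives [delta], and with (a, b) it gives [lam]. *)
Let deltaE u : W u ->
  delta u = (p%:R - 1) * (b u * (r u)^-1) - (q%:R - 1) * (a u * (s u)^-1).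
Proof.
move=> uW; transitivity (delta u * (a u ^+ 2 + b u ^+ 2)); first by rewrite ab1// mulr1.
transitivity (b u * (- (kap u * a u) + delta u * b u) - a u * (- (kap u * b u) - delta u * a u)).
  by move: (delta u) (kap u) => *; ring_at u.
by rewrite lap_r// lap_s//; ring.
Qed.

Let lamE u : W u -> lam u =
  - (kap u + (p%:R - 1) * (a u * (r u)^-1) + (q%:R - 1) * (b u * (s u)^-1)).
Proof.
move=> uW; have U := ab1 uW.
have E : - kap u * (a u ^+ 2 + b u ^+ 2) = lam u * (a u ^+ 2 + b u ^+ 2)
   + (p%:R - 1) * (a u * (r u)^-1) + (q%:R - 1) * (b u * (s u)^-1).
  transitivity (a u * (- (kap u * a u) + delta u * b u) + b u * (- (kap u * b u) - delta u * a u)).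
    by move: (delta u) (kap u) => *; ring_at u.
  by rewrite lap_r// lap_s//; ring.
by move: E; rewrite U !mulr1 => E; rewrite -[kap u]opprK E; ring.
Qed.

Let inv_lam : inv lam.
Proof.
have ir := inv_V inv_r r0; have is_ := inv_V inv_s s0.
apply: (@eq_inv (fun v =>
  - (kap v + (p%:R - 1) * (a v * (r v)^-1) + (q%:R - 1) * (b v * (s v)^-1)))).
  by move=> v; rewrite inE => vW; rewrite lamE.
apply: inv_N; apply: inv_Add; first apply: inv_Add => //.
  by apply: inv_M; [exact: inv_cst|exact: inv_M].
by apply: inv_M; [exact: inv_cst|exact: inv_M].
Qed.

Let lap_La u : W u ->
  Lap (fun v => lam v * a v) u = (p%:R - 1) * (lam u * a u * (r u) ^- 2).
Proof.
move=> uW; have iA : inv (fun v => a v * lam v / r v).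
  by apply: inv_M; [exact: inv_M|exact: inv_V].
rewrite (eq_lap Wo XI (H := fun v => a v * lam v)) //; last 2 first.
- exact: (smoothM Wo).
- by move=> v _; rewrite mulrC.
rewrite (lap_slope_meanc (b := b u) (d := b u * D (fun v => a v * lam v / r v) u)
   Wo XI nm lam_neq0 r_neq0 rotL uW (biharm uW)) ?(mulrC (lam u))//.
- move=> i; rewrite (grad_dot_inv _ (iA.2 u uW)) D_coordL//.
  by move: (_ / _) (vfd _ _ _) => y z; ring_at u.
- by rewrite (grad_dot_inv _ (fun i => partial_r i uW)).
- by rewrite (grad_dot_inv _ (fun i => partial_r i uW)) Dr.
- exact: ab1.
Qed.

Let lap_Lb u : W u ->
  Lap (fun v => lam v * b v) u = (q%:R - 1) * (lam u * b u * (s u) ^- 2).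
Proof.
move=> uW; have iA : inv (fun v => b v * lam v / s v).
  by apply: inv_M; [exact: inv_M|exact: inv_V].
rewrite (eq_lap Wo XI (H := fun v => b v * lam v)) //; last 2 first.
- exact: (smoothM Wo).
- by move=> v _; rewrite mulrC.
(* Here [- a] takes the place of [b], since [D s = - a]. *)
rewrite (lap_slope_meanc (b := - a u) (d := - a u * D (fun v => b v * lam v / s v) u)
   Wo XI nm lam_neq0 s_neq0 rotR uW (biharm uW)) ?(mulrC (lam u))//.
- move=> i; rewrite (grad_dot_inv _ (iA.2 u uW)) D_coordR//.
  by move: (_ / _) (vfd _ _ _) => y z; ring_at u.
- by rewrite (grad_dot_inv _ (fun i => partial_s i uW)).
- by rewrite (grad_dot_inv _ (fun i => partial_s i uW)) Ds.
- by rewrite sqrrN addrC ab1.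
Qed.

Lemma regular_part_empty u : W u -> False.
Proof.
have P : profile W e r s a b kap.
  split=> //; first exact: inv_kap.1.
apply: (profile_minimal P sl (m := p%:R - 1) (l := q%:R - 1)).
- by rewrite subr_ge0 ler1n.
- by rewrite subr_ge0 ler1n.
- exact: lamE.
- move=> v vW; rewrite -deltaE// -lap_inv ?lap_La//; exact: inv_M.
- move=> v vW; rewrite -deltaE// -lap_inv ?lap_Lb//; exact: inv_M.
- exact: l0.
Qed.

End Frame.

(** * Small rotations *)

Section SmallAngle.
Context {R : realType}.

Lemma entry_norm_le n m (A : 'M[R]_(n, m)) i j : `|A i j| <= `|A|.
Proof.
rewrite [leRHS]/Num.Def.normr/= mx_normrE.
exact: (le_bigmax _ (fun ij : 'I_n * 'I_m => `|A ij.1 ij.2|) (i, j)).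
Qed.

Lemma mulmx_norm_le n m (z : 'rV[R]_n) (A : 'M[R]_(n, m)) :
  `|z *m A| <= `|z| * \sum_i \sum_j `|A i j|.
Proof.
rewrite [leLHS]/Num.Def.normr/= mx_normrE bigmax_le//.
  by rewrite mulr_ge0// sumr_ge0// => i _; apply: sumr_ge0.
move=> [i0 j] _ /=; rewrite ord1 mxE mulr_sumr (le_trans (ler_norm_sum _ _ _))//.
apply: ler_sum => i _; rewrite normrM ler_pM//; first exact: entry_norm_le.
by rewrite (bigD1 j)//= lerDl sumr_ge0.
Qed.

(* An immersion is locally bi-Lipschitz, so the displacement of its image in a
   normal direction is negligible. *)
Lemma immersion_normal n m (X : 'rV[R]_n -> 'rV[R]_m) u (v : 'rV[R]_m) (eps : R) :
  differentiable X u -> row_free ('J X u) -> v *m ('J X u)^T = 0 -> 0 < eps ->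
  \forall t \near u, `|((X t - X u) *m v^T) ord0 ord0| <= eps * `|X t - X u|.
Proof.
move=> dX /row_freeP[K JK] vJ e0; set J := 'J X u in JK vJ.
pose CK := 1 + \sum_i \sum_j `|K i j|.
pose Cv := 1 + \sum_i \sum_j `|v^T i j|.
have sum_ge0 a b (A : 'M[R]_(a, b)) : 0 <= \sum_i \sum_j `|A i j|.
  by apply: sumr_ge0 => i _; apply: sumr_ge0.
have CK0 : 0 < CK by rewrite ltr_wpDr.
have Cv0 : 0 < Cv by rewrite ltr_wpDr.
have le_CK (z : 'rV[R]_m) : `|z *m K| <= `|z| * CK.
  by rewrite (le_trans (mulmx_norm_le _ _))// ler_wpM2l// lerDr.
have le_Cv (z : 'rV[R]_m) : `|(z *m v^T) ord0 ord0| <= `|z| * Cv.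
  rewrite (le_trans (entry_norm_le _ _ _))// (le_trans (mulmx_norm_le _ _))//.
  by rewrite ler_wpM2l// lerDr.
(* The first bound lets half of [|h|] be absorbed, so that [|h| <= 2 * CK * |g|]; the second turns
   the normal error [d * |h| * Cv] into [eps * |g|]. *)
pose d := Num.min (1 / (2 * CK)) (eps / (2 * CK * Cv)).
have d0 : 0 < d by rewrite lt_min !divr_gt0// ?mulr_gt0.
have /eqaddoP/(_ _ d0) := diff_locally dX.
move=> H; apply/nbhs0P; apply: filterS H => h /= H'.
have H : `|X (u + h) - (X u + 'd X u h)| <= d * `|h|.
  by move: H'; rewrite !fctE /= (addrC h u).
set g := X (u + h) - X u; pose rho := g - h *m J.
have hJ : 'd X u h = h *m J by rewrite /J mul_rV_lin1.
have rho_le : `|rho| <= d * `|h|.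
  by rewrite /rho /g -hJ -addrA -opprD; exact: H.
have h_le : `|h| <= 2 * CK * `|g|.
  have hE : h = g *m K - rho *m K.
    by rewrite -mulmxBl /rho opprB addrC subrK -mulmxA JK mulmx1.
  have : `|h| <= `|g| * CK + `|rho| * CK.
    by rewrite {1}hE (le_trans (ler_normB _ _))// lerD// le_CK.
  have dCK : `|rho| * CK <= `|h| / 2.
    rewrite (le_trans (ler_wpM2r (ltW CK0) rho_le))// mulrAC mulrC ler_wpM2l//.
    rewrite (le_trans (ler_wpM2r (ltW CK0) (_ : d <= 1 / (2 * CK))))//.
      by rewrite ge_min lexx.
    by rewrite mul1r invfM mulfVK// gt_eqF.
  by move: (`|h|) (`|g|) (`|rho| * CK) dCK => x y z; lra.
have -> : g *m v^T = rho *m v^T.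
  by rewrite /rho [RHS]mulmxBl -mulmxA -[J *m _]trmxK trmx_mul trmxK vJ trmx0 mulmx0 subr0.
rewrite (le_trans (le_Cv _))// (le_trans (ler_wpM2r (ltW Cv0) rho_le))//.
have : d * (2 * CK * Cv) <= eps.
  by rewrite -ler_pdivlMr ?mulr_gt0// ge_min lexx orbT.
have H2 := ler_wpM2l (mulr_ge0 (ltW d0) (ltW Cv0)) h_le.
move=> H3; have := ler_wpM2r (normr_ge0 g) H3; apply: le_trans.
by rewrite mulrAC (le_trans H2)// le_eqVlt; apply/orP; left; apply/eqP; ring.
Qed.

End SmallAngle.

Section Rotation.
Context {R : realType} {p : nat}.
Implicit Types (i j : 'I_p) (t : R).

(** The sine of [2 * atan t]. As the cosine minus 1 is [- t * sin_rat t], a rotation moves a vector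
    by exactly [sin_rat t *: (w + t *: w')], and no curve of matrices has to be differentiated. *)
Definition sin_rat t : R := 2 * t / (1 + t ^+ 2).

(* The rotation by the angle [2 * atan t] in the plane of the coordinates i, j *)
Definition rotation i j t : 'M[R]_p :=
  1%:M + sin_rat t *: (delta_mx i j - delta_mx j i - t *: (delta_mx i i + delta_mx j j)).

Lemma sin_ratE t : sin_rat t * (1 + t ^+ 2) = 2 * t.
Proof. by rewrite /sin_rat mulfVK// gt_eqF// ltr_pwDl// sqr_ge0. Qed.

Lemma rotation0 i j : rotation i j 0 = 1%:M.
Proof. by rewrite /rotation /sin_rat mulr0 mul0r scale0r addr0. Qed.

Lemma trmx_rotation i j t : (rotation i j t)^T =
  1%:M + sin_rat t *: (delta_mx j i - delta_mx i j - t *: (delta_mx i i + delta_mx j j)).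
Proof.
by apply/matrixP => k l; rewrite !mxE [l == k]eq_sym !(andbC (l == _)).
Qed.

Lemma rotation_orthogonal i j t : i != j -> orthogonal_group (rotation i j t).
Proof.
move=> ij; rewrite /orthogonal_group /= trmx_rotation /rotation.
have E := sin_ratE t; set c := sin_rat t in E *.
(* [Q] is the projection on the plane of rotation and [S] a quarter turn in it. *)
pose S : 'M[R]_p := delta_mx i j - delta_mx j i.
pose Q : 'M[R]_p := delta_mx i i + delta_mx j j.
have SS : S *m S = - Q.
  rewrite /S mulmxBl !mulmxBr !mul_delta_mx_cond !eqxx [j == i]eq_sym (negbTE ij) /=.
  by rewrite !mulr1n !mulr0n sub0r subr0 /Q opprD.
have SQ : S *m Q = S.
  rewrite /S /Q mulmxBl !mulmxDr !mul_delta_mx_cond !eqxx [j == i]eq_sym (negbTE ij) /=.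
  by rewrite !mulr1n !mulr0n add0r addr0.
have QS : Q *m S = S.
  rewrite /S /Q mulmxDl !mulmxBr !mul_delta_mx_cond !eqxx [j == i]eq_sym (negbTE ij) /=.
  by rewrite !mulr1n !mulr0n sub0r subr0.
have QQ : Q *m Q = Q.
  rewrite /Q mulmxDl !mulmxDr !mul_delta_mx_cond !eqxx [j == i]eq_sym (negbTE ij) /=.
  by rewrite !mulr1n !mulr0n add0r addr0.
rewrite -/S -/Q -[delta_mx j i - _]opprB -/S.
rewrite mulmxDl mul1mx mulmxDr mulmx1 -scalemxAl -scalemxAr.
have -> : (S - t *: Q) *m (- S - t *: Q) = (1 + t ^+ 2) *: Q.
  rewrite mulmxBl !mulmxBr !mulmxN -!scalemxAl -!scalemxAr SS SQ QS QQ.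
  clearbody S Q; apply/matrixP => k l; rewrite !mxE.
  by move: (S k l) (Q k l) => x y; ring.
clearbody S Q; apply/matrixP => k l; rewrite !mxE.
move: (S k l) (Q k l) ((k == l)%:R : R) => x y z.
transitivity (z + c * y * (c * (1 + t ^+ 2) - 2 * t)); first by ring.
by rewrite E subrr mulr0 addr0.
Qed.

Lemma mulmx_rotation i j t (z : 'rV[R]_p) : z *m (rotation i j t)^T =
  z + sin_rat t *: (z *m (delta_mx j i - delta_mx i j)
    + t *: - (z *m (delta_mx i i + delta_mx j j))).
Proof.
rewrite trmx_rotation mulmxDr mulmx1 -scalemxAr mulmxBr -scalemxAr.
by rewrite scalerN.
Qed.

Lemma rotation_continuous i j : {for 0, continuous (rotation i j)}.
Proof.
have sc : {for (0 : R), continuous sin_rat}.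
  apply: cvgM; first by apply: cvgM; [exact: cvg_cst|exact: cvg_id].
  apply: cvgV; first by rewrite expr0n addr0 oner_eq0.
  by apply: cvgD; [exact: cvg_cst|apply: cvgM; exact: cvg_id].
apply: cvgD; first exact: cvg_cst.
apply: cvgZ; first exact: sc.
apply: cvgB; first exact: cvg_cst.
by apply: cvgZ; [exact: cvg_id|exact: cvg_cst].
Qed.

End Rotation.

(** * Tangency to the orbits *)

Section Orbits.
Context {R : realType} {n p q : nat} {M : topologicalType}.
Variables (f : M -> 'rV[R]_(p + q)) (U : set 'rV[R]_n) (c : 'rV[R]_n -> M).
Hypothesis hinv : OpOq_invariant f.
Hypothesis par : parametrization f U c.
Local Notation X := (f \o c).

(** The action is continuous and [c] maps open sets to open sets, so a small motion keeps [c u] in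
    the image of a given neighbourhood. The lift [v] is found for each [t] separately, with no
    regularity in [t]; hence [immersion_normal] compares displacements and not velocities. *)
Lemma lift_motion (P : set 'rV[R]_n) (phi1 : R -> 'M[R]_p) (phi2 : R -> 'M[R]_q) u :
  {for 0, continuous phi1} -> {for 0, continuous phi2} ->
  phi1 0 = 1%:M -> phi2 0 = 1%:M ->
  (forall t, orthogonal_group (phi1 t)) -> (forall t, orthogonal_group (phi2 t)) ->
  U u -> nbhs u P ->
  \forall t \near (0 : R), exists v, P v /\ X v = OpOq_act (phi1 t) (phi2 t) (X u).
Proof.
move=> c1 c2 e1 e2 o1 o2 uU uP.
have [Uo _ _ open_map _] := par; have [a [ac a1 _ af]] := hinv.
have UP : nbhs u (P `&` U) by apply: filterI => //; exact: open_nbhs_nbhs.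
pose V := (P `&` U)^°.
have Vo : open V by exact: open_interior.
have VU : V `<=` P `&` U by exact: interior_subset.
have Vu : V u by exact: UP.
have cVo : open (c @` V) by apply: open_map => // v /VU[].
pose S := (@orthogonal_group R p `*` @orthogonal_group R q) `*` [set: M].
pose z0 : 'M[R]_p * 'M[R]_q * M := (1%:M, 1%:M, c u).
have Sz0 : S z0.
  by split=> //; split; rewrite /orthogonal_group /= mul1mx trmx1.
have cV : nbhs (a z0.1.1 z0.1.2 z0.2) (c @` V).
  by rewrite a1; apply: open_nbhs_nbhs; split=> //; exists u.
have H := (subspace_continuousP S _).1 ac z0 Sz0 _ cV.
have phic : (phi1 t, phi2 t, c u) @[t --> (0 : R)] --> z0.
  have c1' : phi1 @ (0 : R) --> nbhs (1%:M : 'M[R]_p) by rewrite -e1; exact: c1.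
  have c2' : phi2 @ (0 : R) --> nbhs (1%:M : 'M[R]_q) by rewrite -e2; exact: c2.
  have c3' : (fun=> c u) @ (0 : R) --> nbhs (c u) by exact: cvg_cst.
  exact: (cvg_pair (cvg_pair c1' c2') c3').
have K : \forall t \near (0 : R), S (phi1 t, phi2 t, c u) ->
    (c @` V) (a (phi1 t) (phi2 t) (c u)) := phic _ H.
apply: filterS K => t K.
have [v Vv cv] : (c @` V) (a (phi1 t) (phi2 t) (c u)).
  by apply: K; split=> //; split; [exact: o1|exact: o2].
exists v; split; first by have [] := VU _ Vv.
by rewrite /= cv af.
Qed.

(** The displacement is [sin_rat t *: (w + t *: w')], and its component along the normal [v] is
    negligible against its length. After division by [sin_rat t], small [t] leaves only the product
    of [w] and [v]. *)
Lemma tangent_motion (phi1 : R -> 'M[R]_p) (phi2 : R -> 'M[R]_q) u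
    (w w' v : 'rV[R]_(p + q)) :
  {for 0, continuous phi1} -> {for 0, continuous phi2} ->
  phi1 0 = 1%:M -> phi2 0 = 1%:M ->
  (forall t, orthogonal_group (phi1 t)) -> (forall t, orthogonal_group (phi2 t)) ->
  U u -> v *m ('J X u)^T = 0 ->
  (forall t, OpOq_act (phi1 t) (phi2 t) (X u) = X u + sin_rat t *: (w + t *: w')) ->
  (w *m v^T) ord0 ord0 = 0.
Proof.
move=> c1 c2 e1 e2 o1 o2 uU vJ act; apply/eqP; rewrite -normr_eq0 -[_ == 0]negbK.
apply/negP => A_neq0; set A := `|_| in A_neq0.
have A0 : 0 < A by rewrite lt_neqAle eq_sym A_neq0 normr_ge0.
(* [B] collects the error terms, all at most [e] times a summand since [t <= e]; then
   [A <= e * B = A / 2] is the contradiction. *)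
pose B := `|(w' *m v^T) ord0 ord0| + `|w| + `|w'| + 1.
have B0 : 0 < B by rewrite ltr_pwDr// !addr_ge0.
pose e := A / (2 * B).
have e0 : 0 < e by rewrite divr_gt0// mulr_gt0.
have [_ _ _ _ [sX XJ]] := par.
have near_e := immersion_normal (sX [::] u uU) (XJ u uU) vJ e0.
have /nbhs_ballP[d d0 Hd] := lift_motion c1 c2 e1 e2 o1 o2 uU near_e.
have dpos : 0 < d by [].
pose t := Num.min (d / 2) (Num.min e 1).
have t0 : 0 < t by rewrite !lt_min divr_gt0// e0 ltr01.
have te : t <= e by rewrite !ge_min lexx orbT.
have t1 : t <= 1 by rewrite !ge_min lexx !orbT.
have td : t < d by rewrite (@le_lt_trans _ _ (d / 2)) ?ge_min ?lexx// ltr_pdivrMr// ltr_pMr// ltr1n.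
have [|z [zP Xz]] := Hd t.
  by rewrite /ball /= sub0r normrN gtr0_norm.
have {zP} : `|((X z - X u) *m v^T) ord0 ord0| <= e * `|X z - X u| by exact: zP.
rewrite Xz act addrAC subrr add0r -scalemxAl mxE normrM [`|sin_rat t *: _|]normrZ [e * _]mulrCA.
have s0 : 0 < `|sin_rat t|.
  by rewrite normr_gt0 gt_eqF// /sin_rat divr_gt0 ?mulr_gt0// ltr_pwDl// sqr_ge0.
rewrite ler_pM2l// mulmxDl -scalemxAl mxE [X in _ + X]mxE => H.
have H1 : `|w + t *: w'| <= `|w| + `|w'|.
  rewrite (le_trans (ler_normD _ _))// lerD2l normrZ gtr0_norm//.
  by rewrite ler_piMl.
have HA : A <= `|(w *m v^T) ord0 ord0 + t * (w' *m v^T) ord0 ord0| + t * `|(w' *m v^T) ord0 ord0|.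
  rewrite /A -{1}[(w *m v^T) ord0 ord0](addrK (t * (w' *m v^T) ord0 ord0)).
  by rewrite (le_trans (ler_normB _ _))// normrM (gtr0_norm t0).
have HH : `|(w *m v^T) ord0 ord0 + t * (w' *m v^T) ord0 ord0| <= e * (`|w| + `|w'|).
  by apply: (le_trans H); rewrite ler_wpM2l// ltW.
have HB : t * `|(w' *m v^T) ord0 ord0| <= e * `|(w' *m v^T) ord0 ord0| by rewrite ler_wpM2r.
have eB : e * B = A / 2 by rewrite /e; field; rewrite gt_eqF.
have : A <= e * B.
  apply: (le_trans HA); apply: (le_trans (lerD HH HB)).
  rewrite -mulrDr ler_wpM2l ?(ltW e0)// /B.
  by move: `|w| `|w'| => x y; lra.
by rewrite eB; lra.
Qed.

Lemma rotation_tangentL u (v : 'rV[R]_(p + q)) : U u -> v *m ('J X u)^T = 0 ->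
  forall i j, coordf X (lshift q i) u * v ord0 (lshift q j) =
              coordf X (lshift q j) u * v ord0 (lshift q i).
Proof.
move=> uU vJ i j; have [->//|ij] := eqVneq i j.
pose z := lsubmx (X u).
pose w := row_mx (z *m (delta_mx j i - delta_mx i j)) (0 : 'rV[R]_q).
pose w' := row_mx (- (z *m (delta_mx i i + delta_mx j j))) (0 : 'rV[R]_q).
have := @tangent_motion (rotation i j) (fun=> 1%:M) u w w' v.
move=> /(_ (@rotation_continuous _ _ i j) (@cst_continuous _ _ _ _) (rotation0 i j) erefl).
move=> /(_ (fun t => rotation_orthogonal t ij)).
have o1 (t : R) : orthogonal_group (1%:M : 'M[R]_q) by rewrite /orthogonal_group /= mul1mx trmx1.
move=> /(_ o1 uU vJ) H.
have wv : (w *m v^T) ord0 ord0 = 0.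
  apply: H => t; rewrite /OpOq_act mulmx_rotation trmx1 mulmx1 -/z.
  rewrite /w /w' scale_row_mx scaler0 add_row_mx addr0 scale_row_mx scaler0.
  by rewrite -[X in _ = X + _]hsubmxK add_row_mx addr0.
have D k l : (z *m delta_mx k l *m (lsubmx v)^T) ord0 ord0 = z ord0 k * lsubmx v ord0 l.
  by rewrite -(mul_delta_mx (0 : 'I_1) k l) mulmxA -colE -mulmxA -rowE mxE big_ord1 !mxE.
move: wv; rewrite -{1}[v]hsubmxK tr_row_mx mul_row_col mul0mx addr0 mulmxBr mulmxBl.
rewrite mxE [X in _ + X]mxE !D !coordfE !mxE => /eqP; rewrite subr_eq0 => /eqP E.
by rewrite E.
Qed.

Lemma rotation_tangentR u (v : 'rV[R]_(p + q)) : U u -> v *m ('J X u)^T = 0 ->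
  forall i j, coordf X (rshift p i) u * v ord0 (rshift p j) =
              coordf X (rshift p j) u * v ord0 (rshift p i).
Proof.
move=> uU vJ i j; have [->//|ij] := eqVneq i j.
pose z := rsubmx (X u).
pose w := row_mx (0 : 'rV[R]_p) (z *m (delta_mx j i - delta_mx i j)).
pose w' := row_mx (0 : 'rV[R]_p) (- (z *m (delta_mx i i + delta_mx j j))).
have := @tangent_motion (fun=> 1%:M) (rotation i j) u w w' v.
move=> /(_ (@cst_continuous _ _ _ _) (@rotation_continuous _ _ i j) erefl (rotation0 i j)).
have o1 (t : R) : orthogonal_group (1%:M : 'M[R]_p) by rewrite /orthogonal_group /= mul1mx trmx1.
move=> /(_ o1 (fun t => rotation_orthogonal t ij) uU vJ) H.
have wv : (w *m v^T) ord0 ord0 = 0.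
  apply: H => t; rewrite /OpOq_act mulmx_rotation trmx1 mulmx1 -/z.
  rewrite /w /w' scale_row_mx scaler0 add_row_mx addr0 scale_row_mx scaler0.
  by rewrite -[X in _ = X + _]hsubmxK add_row_mx addr0.
have D k l : (z *m delta_mx k l *m (rsubmx v)^T) ord0 ord0 = z ord0 k * rsubmx v ord0 l.
  by rewrite -(mul_delta_mx (0 : 'I_1) k l) mulmxA -colE -mulmxA -rowE mxE big_ord1 !mxE.
move: wv; rewrite -{1}[v]hsubmxK tr_row_mx mul_row_col mul0mx add0r mulmxBr mulmxBl.
rewrite mxE [X in _ + X]mxE !D !coordfE !mxE => /eqP; rewrite subr_eq0 => /eqP E.
by rewrite E.
Qed.

End Orbits.

(** * Conclusion *)

(* The coordinate hyperplane is then the tangent space, so the mean curvature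
   vector is a multiple of the basis vector k, and its k-th coordinate vanishes. *)
Lemma coordf0_lap0 (R : realType) (n m : nat) (W : set 'rV[R]_n)
    (X : 'rV[R]_n -> 'rV[R]_m) (k : 'I_m) :
  open W -> smooth_immersion W X -> n.+1 = m ->
  (forall u, W u -> coordf X k u = 0) ->
  forall u k', W u -> lap X (coordf X k') u = 0.
Proof.
move=> Wo XI nm X0 u k' uW; have uW' : u \in W by rewrite inE.
have sX := smooth_coordf Wo XI.
pose v : 'rV[R]_m := delta_mx 0 k.
have v0 : v != 0.
  by apply/eqP => /rowP/(_ k)/eqP; rewrite !mxE !eqxx oner_eq0.
have vJ : v *m ('J X u)^T = 0.
  apply/rowP => l; rewrite [RHS]mxE -rowE mxE mxE (jacobianE XI)//.
  rewrite (eq_partial Wo l (G := fun=> 0) _ uW').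
    exact: partial_cst.
  by move=> w; rewrite inE; exact: X0.
have Lk : lap X (coordf X k) u = 0.
  rewrite (eq_lap Wo XI (H := fun v => 0 * coordf X k v) (sX k) _ uW).
    by rewrite (lapZ Wo XI 0 (sX k) uW) mul0r.
  by move=> w; rewrite inE => wW; rewrite mul0r X0.
pose eta : 'rV[R]_m := \row_k' lap X (coordf X k') u.
have eP : eta *m tangent_proj X u = 0.
  by rewrite /tangent_proj !mulmxA (meanc_normal Wo XI uW) !mul0mx.
have ev : eta *m v^T = 0.
  by rewrite trmx_delta -colE; apply/matrixP => i j; rewrite !mxE.
move: eP; rewrite (tangent_proj_normal XI nm uW v0 vJ) mulmxBr mulmx1 -scalemxAr.
by rewrite mulmxA ev mul0mx scaler0 subr0 => /rowP/(_ k'); rewrite !mxE.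
Qed.

Lemma sum_sqr_eq0 (R : realType) (c : nat) (F : 'I_c -> R) :
  \sum_i F i ^+ 2 = 0 -> forall i, F i = 0.
Proof.
move=> /eqP; rewrite psumr_eq0 => [/allP F0 i|i _]; last exact: sqr_ge0.
by apply/eqP; rewrite -sqrf_eq0; apply: F0; rewrite mem_index_enum.
Qed.

Theorem corollary3p6 (R : realType) (p q : nat) (M : topologicalType)
    (f : M -> 'rV[R]_(p + q)) (hp : (0 < p)%N) (hq : (0 < q)%N)
    (hM : immersed_hypersurface f) (hinv : OpOq_invariant f)
    (hbih : biharmonic f) :
  minimal f.
Proof.
move=> U c par u0 u0U; have [Uo _ _ _ XI] := par.
set X := f \o c; set n := (p + q).-1 in U c par u0 u0U Uo XI X *.
have nm : n.+1 = (p + q)%N by rewrite prednK// addn_gt0 hp.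
(* As [p + q >= 2], the dimension [n] is positive and the factor [1 / n] of the mean curvature
   vector can be cancelled. *)
have n0 : n%:R^-1 != 0 :> R.
  by rewrite invr_eq0 pnatr_eq0 -lt0n -ltnS nm -(addn1 1) leq_add.
have sL k : smooth_on U (lap X (coordf X k)).
  exact: (smooth_lap Uo XI (smooth_coordf Uo XI k)).
have biharm u k : U u -> lap X (lap X (coordf X k)) u = 0.
  move=> uU; have /rowP/(_ k) := hbih U c par u uU; rewrite !mxE => E.
  apply: (mulfI n0); rewrite mulr0 -(lapZ Uo XI _ (sL k) uU) -[RHS]E -lap_laplacian.
  apply: (eq_lap Uo XI) => //.
    by apply: (smoothM Uo) => //; exact: (smooth_cst Uo).
  by move=> v; rewrite inE => vU; rewrite (mean_curvature_coord Uo XI).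
have sub W Y : W `<=` U -> smooth_on U Y -> smooth_on W Y.
  by move=> WU; exact: smooth_on_subset.
have subI W : W `<=` U -> smooth_immersion W X.
  move=> WU; split; first exact: smooth_on_subset XI.1.
  by move=> u /WU; exact: XI.2.
have sum_smooth (c' : nat) (F : 'I_c' -> 'rV[R]_n -> R) :
    (forall i, smooth_on U (F i)) -> smooth_on U (fun u => \sum_i F i u ^+ 2).
  by move=> sF; apply: (smooth_sum Uo) => i; apply: (smoothX Uo).
apply: contrapT => H0.
pose W1 := U `&` [set u | \sum_k lap X (coordf X k) u ^+ 2 != 0].
have W1o : open W1 by apply: open_nonzero => //; exact: sum_smooth.
have W1U : W1 `<=` U by move=> u [].
have W1u0 : W1 u0.
  split=> //=; apply/eqP => /sum_sqr_eq0 L0; apply: H0; apply/rowP => k.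
  by rewrite (mean_curvature_coord Uo XI)// L0 mulr0 mxE.
(* A block vanishing on all of [W] contains at least one coordinate, which then vanishes on [W]; by
   [coordf0_lap0] the mean curvature would vanish as well, which [W1] excludes. *)
have nonzero W (c' : nat) (iota : 'I_c' -> 'I_(p + q)) :
    (0 < c')%N -> open W -> W `<=` W1 -> W !=set0 ->
    open (W `&` [set u | \sum_i coordf X (iota i) u ^+ 2 != 0]) /\
    (W `&` [set u | \sum_i coordf X (iota i) u ^+ 2 != 0]) !=set0.
  move=> c'0 Wo WW1 [w Ww]; have WU : W `<=` U by move=> u /WW1/W1U.
  split.
    apply: open_nonzero => //; apply: (smooth_on_subset WU); apply: sum_smooth => i.
    exact: (smooth_coordf Uo XI).
  apply: contrapT => /set0P/negP/negPn/eqP E.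
  have X0 u : W u -> coordf X (iota (Ordinal c'0)) u = 0.
    move=> uW; have := E; rewrite -subset0 => /(_ u) N.
    have /sum_sqr_eq0 : \sum_i coordf X (iota i) u ^+ 2 = 0.
      by apply/eqP/negPn/negP => ne; apply: N.
    exact.
  have [_ /eqP] := WW1 w Ww; apply.
  rewrite big1// => k _.
  by rewrite (coordf0_lap0 Wo (subI W WU) nm X0 k Ww) expr0n.
have [W2o W2n] := nonzero W1 p (@lshift p q) hp W1o (fun _ => id) (ex_intro _ u0 W1u0).
set W2 := _ `&` _ in W2o W2n.
have W21 : W2 `<=` W1 by move=> u [].
have [W3o [u W3u]] := nonzero W2 q (@rshift p q) hq W2o W21 W2n.
have W3U : forall v, (W2 `&` [set u | \sum_i coordf X (rshift p i) u ^+ 2 != 0]) v -> U v.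
  by move=> v [/W21/W1U].
apply: (regular_part_empty W3o (subI _ W3U) nm hp hq _ _ _ _ _ _ W3u).
- by move=> v [[[]]].
- by move=> v [[]].
- by move=> v [].
- by move=> v z /W3U vU vJ i j; exact: (rotation_tangentL hinv par vU vJ).
- by move=> v z /W3U vU vJ i j; exact: (rotation_tangentR hinv par vU vJ).
- by move=> v /W3U vU k; exact: biharm.
Qed.
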